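(* Let $r,T,\sigma,\rho,\alpha_1,\alpha_2,\beta_1,\gamma_1>0$, $\theta\geq0$ and $v,x_1\in\mathbb{R}$. Let $(\bar I_1,\bar C_1)$ be an optimal admissible pair for the functional $J_0$ (the rational decisions) and let $(I_1^*,C_1^* )$ be an optimal admissible pair for the functional $J_\theta$ (the optimal decisions under investment herding), as defined in the context. Then the crowding-out consumption $\mathscr{C}:=\bar C_1(t)-C_1^*(t)$ is (for almost every $t\in[0,T]$) a constant independent of $t$, given by $$\mathscr{C}=\frac{\alpha_1\sigma^2}{2}\left(\frac{\beta_1}{\alpha_1}+\frac{e^{rT}-1}{r}\right)^{-1}\int_0^Te^{2r(T-t)}[I_1^*(t)-\bar I_1(t)]^2\,dt\;\geq\;0.$$
   Context: Let $B$ be a standard Brownian motion on a complete filtered probability space. The market has a risk-free asset with interest rate $r$ and a risky asset with excess return rate $v$ and volatility $\sigma$; the time horizon is $[0,T]$. An admissible pair $(I_1,C_1)$ consists of deterministic measurable functions on $[0,T]$: an investment decision $I_1\in L^2([0,T])$ (of arbitrary sign) and a consumption decision $C_1\in L^1([0,T])$ with $C_1(t)>0$ for almost every $t$. Functions equal almost everywhere are identified. Given an admissible pair, the fund process $X_1$ solves $$dX_1(t)=[rX_1(t)+vI_1(t)-C_1(t)]\,dt+\sigma I_1(t)\,dB(t),\qquad X_1(0)=x_1.$$ Let $\bar I_2(t)=\frac{v}{\alpha_2\sigma^2}e^{r(t-T)}$ be the (given) investment decision of the leading household. For $\theta\ge 0$ (the herd coefficient) define $$J_\theta(I_1,C_1)=\mathbb{E}\left[-\frac{1}{\alpha_1}e^{-\alpha_1X_1(T)}\right]+\gamma_1\int_0^T\left(-\frac{1}{\beta_1}e^{-\rho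 rt-\beta_1C_1(t)}\right)dt-\frac{\theta}{2}\int_0^Te^{\rho r(T-t)}[I_1(t)-\bar I_2(t)]^2\,dt.$$ A pair is optimal for $J_\theta$ if it is admissible and attains the supremum of $J_\theta$ over all admissible pairs. *)

(* Defs.v *)
From HB Require Import structures.
From mathcomp Require Import all_boot all_order all_algebra.
From mathcomp Require Import all_classical all_reals all_analysis.
Import Order.TTheory GRing.Theory Num.Theory.
Import numFieldNormedType.Exports.

Set Implicit Arguments.
Unset Strict Implicit.
Unset Printing Implicit Defensive.

Local Open Scope classical_set_scope.
Local Open Scope ring_scope.

Section stochastic_basis.
Context {R : realType} {d : measure_display} {Omega : measurableType d}.
Variables (P : probability Omega R) (T : R).

                                                                              
Definition filtration (F : R -> set (set Omega)) : Prop :=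
  (forall t, 0 <= t <= T -> sigma_algebra [set: Omega] (F t)) /\
  (forall t, 0 <= t <= T -> F t `<=` measurable) /\
  (forall s t, 0 <= s -> s <= t -> t <= T -> F s `<=` F t).

Definition complete_filtered_space (F : R -> set (set Omega)) : Prop :=
  measure_is_complete P /\ filtration F /\
  (forall t, 0 <= t <= T -> forall N, P.-negligible N -> F t N).

Definition adapted (F : R -> set (set Omega)) (X : R -> Omega -> R) : Prop :=
  forall t, 0 <= t <= T -> forall A : set R, measurable A -> F t (X t @^-1` A).

Definition continuous_paths (X : R -> Omega -> R) : Prop :=
  {ae P, forall w, {within `[0, T], continuous (fun t => X t w)}}.

Definition increment (B : R -> Omega -> R) (s t : R) (w : Omega) : R :=
  B t w - B s w.

                                                                   
Definition brownian_motion (F : R -> set (set Omega)) (B : R -> Omega -> R)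
  : Prop :=
  adapted F B /\
  continuous_paths B /\
  {ae P, forall w, B 0 w = 0} /\
  (forall s t : R, 0 <= s -> s < t -> t <= T ->
     forall A : set R, measurable A ->
     P (increment B s t @^-1` A) = normal_prob 0 (Num.sqrt (t - s)) A) /\
  (forall s t : R, 0 <= s -> s < t -> t <= T ->
     forall (E : set Omega) (A : set R), F s E -> measurable A ->
     P (E `&` increment B s t @^-1` A)
       = (P E * P (increment B s t @^-1` A))%E).

                                                        
                         
Definition step_in (t : R) (l : seq (R * R * R)) : bool :=
  all (fun q => [&& 0 <= q.1.2, q.1.2 <= q.2 & q.2 <= t]) l.

Definition step_fun (l : seq (R * R * R)) (x : R) : R :=
  \sum_(q <- l) q.1.1 * \1_(`]q.1.2, q.2]) x.

Definition step_integral (B : R -> Omega -> R) (l : seq (R * R * R))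
    (w : Omega) : R :=
  \sum_(q <- l) q.1.1 * increment B q.1.2 q.2 w.

                                                                             
                                                                              
                     
Definition is_ito_integral (B : R -> Omega -> R) (f : R -> R) (t : R)
    (Y : Omega -> R) : Prop :=
  measurable_fun [set: Omega] Y /\
  exists l : nat -> seq (R * R * R),
    (forall n, step_in t (l n)) /\
    ((\int[lebesgue_measure]_(x in `[0%R, t])
        ((f x - step_fun (l n) x) ^+ 2)%:E)%E @[n --> \oo] --> 0%E) /\
    ('E_P[fun w => ((Y w - step_integral B (l n) w) ^+ 2)%R]%E
        @[n --> \oo] --> 0%E).

                                                           
Definition ito_integral_process (B : R -> Omega -> R) (f : R -> R)
    (M : R -> Omega -> R) : Prop :=
  continuous_paths M /\
  forall t, 0 <= t <= T -> is_ito_integral B f t (M t).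

End stochastic_basis.

                                                                       
                                                                             
Definition admissible {R : realType} (T : R) (I C : R -> R) : Prop :=
  measurable_fun `[0, T] I /\
  lebesgue_measure.-integrable `[0, T] (fun t => (I t ^+ 2)%:E) /\
  lebesgue_measure.-integrable `[0, T] (fun t => (C t)%:E) /\
  {ae lebesgue_measure, forall t, t \in `[0, T] -> 0 < C t}.

                                                                          
Definition fund_process {R : realType} {d : measure_display}
    {Omega : measurableType d} (P : probability Omega R)
    (F : R -> set (set Omega)) (B : R -> Omega -> R)
    (r T sigma v x1 : R) (I C : R -> R) (X : R -> Omega -> R) : Prop :=
  adapted T F X /\
  continuous_paths P T X /\
  exists M, ito_integral_process P T B I M /\
    {ae P, forall w, forall t, 0 <= t <= T ->
      X t w = x1
        + \int[lebesgue_measure]_(s in `[0, t]) (r * X s w + v * I s - C s)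
        + sigma * M t w}.

Definition leader_investment {R : realType} (r T sigma alpha2 v t : R) : R :=
  v / (alpha2 * sigma ^+ 2) * expR (r * (t - T)).

                                                  
Definition J {R : realType} {d : measure_display} {Omega : measurableType d}
    (P : probability Omega R)
    (r T sigma rho alpha1 alpha2 beta1 gamma1 theta v : R)
    (I C : R -> R) (X : R -> Omega -> R) : \bar R :=
  ('E_P[fun w => (- (alpha1^-1 * expR (- (alpha1 * X T w))))%R]
   + gamma1%:E * \int[lebesgue_measure]_(t in `[0%R, T])
       (- (beta1^-1 * expR (- (rho * r * t) - beta1 * C t)))%:E
   - (theta / 2)%:E * \int[lebesgue_measure]_(t in `[0%R, T])
       (expR (rho * r * (T - t))
          * (I t - leader_investment r T sigma alpha2 v t) ^+ 2)%:E)%E.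

Definition optimal {R : realType} {d : measure_display}
    {Omega : measurableType d} (P : probability Omega R)
    (F : R -> set (set Omega)) (B : R -> Omega -> R)
    (r T sigma rho alpha1 alpha2 beta1 gamma1 theta v x1 : R)
    (I C : R -> R) : Prop :=
  admissible T I C /\
  exists X, fund_process P F B r T sigma v x1 I C X /\
    J P r T sigma rho alpha1 alpha2 beta1 gamma1 theta v I C X =
    ereal_sup [set j | exists I' C' X',
      [/\ admissible T I' C',
          fund_process P F B r T sigma v x1 I' C' X' &
          j = J P r T sigma rho alpha1 alpha2 beta1 gamma1 theta v I' C' X']].

(* Main.v *)
(** With a deterministic investment [I] the terminal wealth is Gaussian, so that
    the expected utility of [X T] is [- exp (- alpha1 K) / alpha1], where the
    certainty equivalent [K] is affine in the consumption and concave quadratic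
    in the investment.  Gaussianity is read off moment generating functions: it
    holds for step integrands by independence of the increments, passes to
    L^2-limits, and then to the almost sure limits of Riemann sums that give the
    Ito integral of [exp (r (T - s)) I s].

    Perturbing an optimal consumption (for either functional) yields
    [gamma1 exp (- rho r t - beta1 C t) = exp (- alpha1 K) exp (r (T - t))] for
    almost every [t], so that [Cbar - Cstar] is almost everywhere the constant
    [c = alpha1 / beta1 * (Kbar - Kstar)].  On the line through [Ibar] and
    [Istar], with consumption [Cbar], [K] is a quadratic polynomial maximal at
    [Ibar]; hence replacing [Ibar] by [Istar] lowers [K] by exactly its quadratic
    term [alpha1 sigma^2 / 2 * int (exp (r (T - t)) (Istar - Ibar))^2].  Replacing
    [Cbar] by [Cstar] raises it by [c (exp (r T) - 1) / r], and solving for [c]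
    gives the formula. *)
Require Import Defs.
From HB Require Import structures.
From mathcomp Require Import all_boot all_order all_algebra.
From mathcomp Require Import ring lra.
From mathcomp Require Import all_classical all_reals all_analysis.
From mathcomp Require Import measurable_realfun.
Import Order.TTheory GRing.Theory Num.Theory.
Import numFieldNormedType.Exports.
Local Open Scope classical_set_scope.
Local Open Scope ring_scope.
Set Implicit Arguments.
Unset Strict Implicit.
Unset Printing Implicit Defensive.

(** * Gaussian moment generating functions *)

(** The law of [X T] enters [J] only through the expectation of [expR (- (alpha1 * X T))], so one
    moment generating function carries all the probability. The obstacle is that exponentials are
    unbounded: neither mean-square nor almost sure convergence passes to them directly, and both are
    first applied to exponentials truncated at [expR k]. The terminal wealth is reached path by
    path: Fubini on a triangle plays the role of an integration by parts, in which the Ito integral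
    is merely a continuous path, and no Ito formula occurs. Optimality compares only pairs that
    possess a fund process, so each competitor needs one of its own; it is built as an affine
    combination of the two given processes plus a deterministic path, without constructing any new
    Ito integral. Neither optimal investment is computed: stationarity of [Ibar] on the line through
    [Istar] is enough, because the certainty equivalent is exactly quadratic there. *)

Lemma ge0_integral_normal (R : realType) (s : R) (f : R -> \bar R) :
  measurable_fun setT f -> (forall x, 0 <= f x)%E ->
  (\int[normal_prob 0 s]_x f x =
   \int[lebesgue_measure]_x (f x * (normal_pdf 0 s x)%:E))%E.
Proof.
move=> mf f0.
have dom := @normal_prob_dominates R 0 s.
rewrite -(Radon_Nikodym_SigmaFinite.change_of_variables dom)//.
have mp : measurable_fun setT (fun x => (normal_pdf 0 s x)%:E).
  by apply/measurable_EFinP; exact: measurable_normal_pdf.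
apply: ae_eq_integral => //.
- apply: emeasurable_funM => //.
  exact: measurable_int (Radon_Nikodym_SigmaFinite.f_integrable dom).
- exact: emeasurable_funM.
(* The Radon-Nikodym derivative and [normal_pdf] have the same integral over every measurable
   set. *)
- apply: ae_eqe_mul2l; apply: integral_ae_eq => //.
  + exact: Radon_Nikodym_SigmaFinite.f_integrable.
  + move=> A _ mA.
    by rewrite -(Radon_Nikodym_SigmaFinite.f_integral dom).
Qed.

(** Completing the square: tilting the centred density by [expR (a * x)] yields a constant times the
    normal density with mean [a * s ^+ 2]. *)
Lemma normal_mgf (R : realType) (s a : R) : s != 0 ->
  (\int[normal_prob 0 s]_x (expR (a * x))%:E = (expR (a ^+ 2 / 2 * s ^+ 2))%:E)%E.
Proof.
move=> s0.
rewrite ge0_integral_normal; last 2 first.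
- apply/measurable_EFinP; apply: measurableT_comp => //; exact: mulrl_measurable.
- by move=> x; rewrite lee_fin expR_ge0.
transitivity (\int[lebesgue_measure]_x
   ((expR (a ^+ 2 / 2 * s ^+ 2))%:E * (normal_pdf (a * s ^+ 2) s x)%:E))%E.
  apply: eq_integral => x _; rewrite -!EFinM; congr EFin.
  rewrite !normal_pdfE// /normal_fun mulrCA [RHS]mulrCA -!expRD.
  congr (_ * expR _); field; exact: s0.
rewrite integralZl//; last exact: integrable_normal_pdf.
by rewrite integral_normal_pdf mule1.
Qed.

(** Independence on rectangles identifies the law of the pair with the product of the laws, and
    Tonelli concludes. Nonnegative extended functions are the right setting because the exponentials
    are not yet known to be integrable. *)
Lemma indep_ge0_integralM (R : realType) (d : measure_display)
    (Omega : measurableType d) (P : probability Omega R) (U V : Omega -> R)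
    (f g : R -> \bar R) :
  measurable_fun setT U -> measurable_fun setT V ->
  (forall A B : set R, measurable A -> measurable B ->
    P (U @^-1` A `&` V @^-1` B) = (P (U @^-1` A) * P (V @^-1` B))%E) ->
  measurable_fun setT f -> measurable_fun setT g ->
  (forall x, 0 <= f x)%E -> (forall x, 0 <= g x)%E ->
  (\int[P]_w (f (U w) * g (V w)) = \int[P]_w f (U w) * \int[P]_w g (V w))%E.
Proof.
move=> mU mV ind mf mg f0 g0.
pose X : {RV P >-> R} := HB.pack_for {mfun Omega >-> R} U
  (isMeasurableFun.Build _ _ _ _ _ mU).
pose Y : {RV P >-> R} := HB.pack_for {mfun Omega >-> R} V
  (isMeasurableFun.Build _ _ _ _ _ mV).
have mUV : measurable_fun setT (fun w => (U w, V w)) by exact: measurable_fun_pair.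
pose Z : {RV P >-> (R * R)%type} := HB.pack_for {mfun Omega >-> (R * R)%type}
  (fun w => (U w, V w)) (isMeasurableFun.Build _ _ _ _ _ mUV).
have mfg : measurable_fun setT (fun z : R * R => f z.1 * g z.2)%E.
  by apply: emeasurable_funM; exact: measurableT_comp.
have fg0 (z : R * R) : (0 <= f z.1 * g z.2)%E by exact: mule_ge0.
transitivity (\int[distribution P Z]_z (f z.1 * g z.2))%E.
  by rewrite ge0_integral_distribution.
transitivity (\int[distribution P X \x distribution P Y]_z (f z.1 * g z.2))%E.
  apply: eq_measure_integral => A mA _; apply/esym.
  exact: product_measure_unique.
rewrite fubini_tonelli1//= /fubini_F /=.
under eq_integral do rewrite ge0_integralZl//.
have g1 : (0 <= \int[distribution P Y]_y g y)%E by exact: integral_ge0.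
rewrite ge0_integralZr// !ge0_integral_distribution//.
Qed.

Lemma le_bounded_integrable (R : realType) (d : measure_display)
    (T : measurableType d) (mu : {measure set T -> \bar R}) (D : set T)
    (f : T -> R) (M : R) :
  measurable D -> (mu D < +oo)%E -> measurable_fun D f ->
  (forall x, D x -> `|f x| <= M) -> mu.-integrable D (EFin \o f).
Proof.
move=> mD muD mf fM; apply: measurable_bounded_integrable => //.
exists M; split; first exact: num_real.
by move=> y My x Dx; exact: le_trans (fM x Dx) (ltW My).
Qed.

Lemma le_expR_minDexpR (R : realType) (x k : R) :
  expR x <= expR (Num.min x k) + expR (- k) * expR (2 * x).
Proof.
case: (leP x k) => [xk|kx].
  by rewrite lerDl mulr_ge0 ?expR_ge0.
rewrite -expRD ler_wpDl ?expR_ge0// ler_expR; lra.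
Qed.

(* Truncating the exponential at [exp k] gives the upper bound by monotone
   convergence; the lower bound controls the tail by
   [exp x <= exp (min x k) + exp (- k) * exp (2 x)]. *)
Lemma mgf_lim (R : realType) (d : measure_display)
    (Omega : measurableType d) (P : probability Omega R)
    (Y_ : nat -> Omega -> R) (Y : Omega -> R) (s_ : nat -> R) (s : R) :
  (forall n, measurable_fun setT (Y_ n)) -> measurable_fun setT Y ->
  (forall n a,
    \int[P]_w (expR (a * Y_ n w))%:E = (expR (a ^+ 2 / 2 * s_ n))%:E)%E ->
  s_ @ \oo --> s ->
  (forall a k, \int[P]_w expR (Num.min (a * Y_ n w) k) @[n --> \oo] -->
               \int[P]_w expR (Num.min (a * Y w) k)) ->
  forall a, (\int[P]_w (expR (a * Y w))%:E = (expR (a ^+ 2 / 2 * s))%:E)%E.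
Proof.
move=> mY_ mY mgfY s_s cvgY a.
have mexp (Z : Omega -> R) : measurable_fun setT Z ->
    measurable_fun setT (fun w => expR (a * Z w)).
  by move=> mZ; apply: measurableT_comp => //; exact: measurable_funM.
have mtr (Z : Omega -> R) k : measurable_fun setT Z ->
    measurable_fun setT (fun w => expR (Num.min (a * Z w) k)).
  move=> mZ; apply: measurableT_comp => //; apply: measurable_minr => //.
  exact: measurable_funM.
have itr (Z : Omega -> R) k : measurable_fun setT Z ->
    P.-integrable setT (EFin \o (fun w => expR (Num.min (a * Z w) k))).
  move=> mZ; apply: (@le_bounded_integrable _ _ _ _ _ _ (expR k)) => //.
  - exact: fin_num_fun_lty.
  - exact: mtr.
  - by move=> w _; rewrite ger0_norm ?expR_ge0// ler_expR ge_min lexx orbT.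
have trE (Z : Omega -> R) k : measurable_fun setT Z ->
    ((\int[P]_w expR (Num.min (a * Z w) k))%:E =
     \int[P]_w (expR (Num.min (a * Z w) k))%:E)%E.
  by move=> mZ; rewrite fineK//; apply: integrable_fin_num => //; exact: itr.
have tr_le (Z : Omega -> R) k : measurable_fun setT Z ->
    ((\int[P]_w expR (Num.min (a * Z w) k))%:E <=
     \int[P]_w (expR (a * Z w))%:E)%E.
  move=> mZ; rewrite trE//; apply: ge0_le_integral => //.
  - by apply/measurable_EFinP; exact: mtr.
  - by apply/measurable_EFinP; exact: mexp.
  - by move=> w _; rewrite lee_fin ler_expR ge_min lexx.
have exp_cvg c : expR (c * s_ n) @[n --> \oo] --> expR (c * s).
  by apply: continuous_cvg; [exact: continuous_expR|exact: cvgMl_tmp].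
have up : (\int[P]_w (expR (a * Y w))%:E <= (expR (a ^+ 2 / 2 * s))%:E)%E.
  have cvg_tr : (\int[P]_w (expR (Num.min (a * Y w) n%:R))%:E)%E @[n --> \oo]
      --> (\int[P]_w (expR (a * Y w))%:E)%E.
    rewrite [X in _ --> X](_ : _ = (\int[P]_w limn
        (fun n => (expR (Num.min (a * Y w) n%:R))%:E))%E); last first.
      apply: eq_integral => w _; apply/esym/cvg_lim => //.
      apply: cvg_near_cst; near=> n; rewrite min_l//.
      near: n; exact: nbhs_infty_ger.
    apply: cvg_monotone_convergence => //.
    - by move=> n; apply/measurable_EFinP; exact: mtr.
    - move=> w _ m n mn; rewrite lee_fin ler_expR.
      by rewrite le_min ge_min lexx/= ge_min ler_nat mn orbT.
  rewrite -(cvg_lim _ cvg_tr)//; apply: lime_le.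
    by apply/cvg_ex; eexists; exact: cvg_tr.
  apply: nearW => k; rewrite -trE// lee_fin.
  apply: (ler_cvg_to (cvgY a k%:R) (exp_cvg (a ^+ 2 / 2))).
  by apply: nearW => n; rewrite -lee_fin -(mgfY n a); exact: tr_le.
apply/eqP; rewrite eq_le up/=.
have int_ge0 : (0 <= \int[P]_w (expR (a * Y w))%:E)%E.
  by apply: integral_ge0 => w _; rewrite lee_fin expR_ge0.
have [x xE] : exists x, (\int[P]_w (expR (a * Y w))%:E = x%:E)%E.
  have fin : (\int[P]_w (expR (a * Y w))%:E \is a fin_num)%E.
    by rewrite ge0_fin_numE// (le_lt_trans up)// ltry.
  by exists (fine (\int[P]_w (expR (a * Y w))%:E)%E); rewrite fineK.
have tr_x k : \int[P]_w expR (Num.min (a * Y w) k) <= x.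
  by rewrite -lee_fin -xE; exact: tr_le.
rewrite xE lee_fin; apply/ler_addgt0Pr => e e0.
(* [C] is the limit of the moment generating functions at [2 * a], and [k] is tuned so that the tail
   term [expR (- k) * C] equals [e]. *)
pose C := expR ((2 * a) ^+ 2 / 2 * s).
have C0 : 0 < C by exact: expR_gt0.
pose k := - ln (e / C).
have kC : expR (- k) * C = e.
  by rewrite /k opprK lnK ?posrE ?divr_gt0// divfK// gt_eqF.
have low n : expR (a ^+ 2 / 2 * s_ n) <=
    \int[P]_w expR (Num.min (a * Y_ n w) k)
    + expR (- k) * expR ((2 * a) ^+ 2 / 2 * s_ n).
  rewrite -lee_fin -(mgfY n a) EFinD trE// EFinM -(mgfY n (2 * a)).
  rewrite -ge0_integralZl//; last first.
    apply/measurable_EFinP; apply: measurableT_comp => //.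
    exact: measurable_funM.
  rewrite -ge0_integralD//; last 2 first.
  - by apply/measurable_EFinP; exact: mtr.
  - apply: measurable_funeM; apply/measurable_EFinP.
    by apply: measurableT_comp => //; exact: measurable_funM.
  apply: ge0_le_integral => //.
  - by apply/measurable_EFinP; exact: mexp.
  - apply: emeasurable_funD.
      by apply/measurable_EFinP; exact: mtr.
    apply: measurable_funeM; apply/measurable_EFinP.
    by apply: measurableT_comp => //; exact: measurable_funM.
  - move=> w _; rewrite -EFinM -EFinD lee_fin -mulrA.
    exact: le_expR_minDexpR.
apply: (@le_trans _ _ (\int[P]_w expR (Num.min (a * Y w) k) + expR (- k) * C)).
  apply: (ler_cvg_to (exp_cvg (a ^+ 2 / 2))); last exact: (nearW _ low).
  by apply: cvgD; [exact: cvgY|apply: cvgMl_tmp; exact: exp_cvg].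
by rewrite kC lerD2r.
Unshelve. all: by end_near. Qed.

(** * Step integrals of Brownian motion *)

Lemma itvcc_bounded_integrable (R : realType) (a b : R) (f : R -> R) (M : R) :
  measurable_fun `[a, b] f -> (forall x, a <= x <= b -> `|f x| <= M) ->
  lebesgue_measure.-integrable `[a, b] (EFin \o f).
Proof.
move=> mf fM; apply: (@le_bounded_integrable _ _ _ _ _ _ M) => //=.
  by rewrite lebesgue_measure_itv/=; case: ifP => _; rewrite ?ltry.
Qed.

(** The last two hypotheses say that neither [a] nor [b] lies strictly inside a cell, which spares
    naming the indices at which they occur as nodes. *)
Lemma sumr_clamp_telescope (R : realType) (G : R -> R) (t : nat -> R) (n : nat)
    (a b : R) :
  (forall i, t i <= t i.+1) -> t 0 <= a -> a <= b -> b <= t n ->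
  (forall i, t i < a -> t i.+1 <= a) -> (forall i, t i < b -> t i.+1 <= b) ->
  G b - G a = \sum_(0 <= i < n) ((a <= t i) && (t i < b))%:R * (G (t i.+1) - G (t i)).
Proof.
move=> tS ta ab bt Ha Hb.
(* Clamping to [a, b] turns the restricted sum into a full telescoping one. *)
pose H x := G (Num.max a (Num.min x b)).
transitivity (H (t n) - H (t 0)).
  by rewrite /H (min_r bt) (max_r ab) (min_l (le_trans ta ab)) (max_l ta).
rewrite -(telescope_sumr (fun i => H (t i)) (leq0n n)); apply: eq_bigr => i _; rewrite /H.
have [ati|tia] := leP a (t i); last first.
  have tSa := Ha _ tia.
  rewrite mul0r (min_l (le_trans (ltW tia) ab)) (max_l (ltW tia)).
  by rewrite (min_l (le_trans tSa ab)) (max_l tSa) subrr.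
have [tib|bti] := ltP (t i) b.
  have tSb := Hb _ tib.
  rewrite mul1r (max_r ati) (min_l tSb).
  by rewrite (max_r (le_trans ati (tS i))).
by rewrite mul0r (min_r (le_trans bti (tS i))) subrr.
Qed.

(** The intervals of [l] may overlap; a common refinement makes the increments consecutive.
    Quantifying over [G] after the coefficients lets the same [c] serve for a path of [B], which
    gives the step integral, and for [u |-> (x <= u)], which gives the step function. *)
Lemma step_partition (R : realType) (T : R) (l : seq (R * R * R)) :
  0 <= T -> step_in T l ->
  exists n (t c : nat -> R),
    [/\ forall i, t i <= t i.+1, 0 <= t 0, t n <= T &
      forall G : R -> R, \sum_(q <- l) q.1.1 * (G q.2 - G q.1.2) =
        \sum_(0 <= i < n) c i * (G (t i.+1) - G (t i))].
Proof.
move=> T0 /allP lT.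
pose s := sort <=%O (0 :: T :: [seq q.1.2 | q <- l] ++ [seq q.2 | q <- l]).
have s0T x : x \in s -> 0 <= x <= T.
  rewrite mem_sort !inE mem_cat => /orP[/eqP->|/orP[/eqP->|/orP[]/mapP[q ql ->]]].
  - by rewrite lexx.
  - by rewrite lexx T0.
  - have /and3P[q0 q1 q2] := lT _ ql.
    by rewrite q0 (le_trans q1 q2).
  - have /and3P[q0 q1 q2] := lT _ ql.
    by rewrite q2 (le_trans q0 q1).
have s_sorted : sorted <=%O s by exact: sort_le_sorted.
(* The default [T] is an upper bound of all nodes, so [t] is nondecreasing on the whole of [nat] and
   equals [T] from index [size s] on. *)
pose t := nth T s.
have tT i : 0 <= t i <= T.
  rewrite /t; have [si|si] := ltnP i (size s).
    by apply: s0T; rewrite mem_nth.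
  by rewrite nth_default// lexx T0.
have t_mono i j : (i <= j)%N -> t i <= t j.
  move=> ij; have [sj|sj] := ltnP j (size s).
    by apply: (sorted_leq_nth le_trans lexx) => //; rewrite inE// (leq_ltn_trans ij).
  by rewrite {2}/t nth_default//; have /andP[] := tT i.
have mem_s x : x \in s -> t 0 <= x /\ x <= t (size s) /\
    (forall i, t i < x -> t i.+1 <= x).
  move=> xs; rewrite -(nth_index T xs) -/(t _); split; [|split].
  - exact: t_mono.
  - by apply: t_mono; exact: index_size.
  - move=> i ti; apply: (t_mono _ _); rewrite ltnNge; apply/negP => /t_mono.
    by rewrite leNgt ti.
exists (size s), t, (fun i => \sum_(q <- l) q.1.1 * ((q.1.2 <= t i) && (t i < q.2))%:R).
split.
- by move=> i; exact: t_mono.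
- by have /andP[] := tT 0.
- by have /andP[] := tT (size s).
- move=> G.
  under [RHS]eq_bigr do rewrite mulr_suml.
  rewrite exchange_big/=; apply: eq_big_seq => q ql.
  have /and3P[_ q12 _] := lT _ ql.
  have [|h1 [h2 h3]] := mem_s q.1.2.
    by rewrite mem_sort !inE mem_cat (map_f (fun q => q.1.2) ql) !orbT.
  have [|k1 [k2 k3]] := mem_s q.2.
    by rewrite mem_sort !inE mem_cat (map_f (fun q => q.2) ql) !orbT.
  rewrite (@sumr_clamp_telescope _ G t (size s) q.1.2 q.2)//; last first.
    by move=> i; exact: t_mono.
  rewrite mulr_sumr.
  by apply: eq_bigr => i _; rewrite mulrA.
Qed.

(** Casts the indicator as an increment of [u |-> (x <= u)], the shape to which [step_partition]
    applies. *)
Lemma indic_itvoc_leB (R : realType) (a b x : R) : a <= b ->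
  \1_`]a, b] x = (x <= b)%R%:R - (x <= a)%R%:R :> R.
Proof.
move=> ab; rewrite indicE mem_setE in_itv/=.
have [xa|ax] := leP x a; first by rewrite (le_trans xa ab) subrr.
by rewrite subr0.
Qed.

(** Disjoint cells leave no cross terms: either [x <= t n] and the last term vanishes, or [x] lies
    beyond all earlier cells. *)
Lemma sqr_sum_disjoint_step (R : realType) (t c : nat -> R) (n : nat) (x : R) :
  (forall i, t i <= t i.+1) ->
  (\sum_(0 <= i < n) c i * ((x <= t i.+1)%R%:R - (x <= t i)%R%:R)) ^+ 2 =
  \sum_(0 <= i < n) c i ^+ 2 * \1_`]t i, t i.+1] x.
Proof.
move=> tS.
have t_mono := homo_leq lexx le_trans tS.
elim: n => [|n IH]; first by rewrite !big_nil expr0n.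
rewrite !big_nat_recr//= -IH indic_itvoc_leB//.
have [xt|tx] := leP x (t n).
  by rewrite (le_trans xt (tS n)) subrr !mulr0 !addr0.
rewrite big_nat_cond big1 ?add0r.
  by rewrite expr0n/= add0r subr0 exprMn; case: (x <= _); rewrite /= ?expr1n ?expr0n.
move=> i; rewrite andbT => /andP[_ ni].
have lt_x j : (j <= n)%N -> (x <= t j) = false.
  by move=> jn; apply/negbTE; rewrite -ltNge (le_lt_trans (t_mono _ _ jn)).
by rewrite !lt_x ?subrr ?mulr0// ltnW.
Qed.

Lemma Rintegral_indic_itvoc (R : realType) (T a b : R) :
  0 <= a -> a <= b -> b <= T ->
  \int[lebesgue_measure]_(x in `[0, T]) \1_`]a, b] x = b - a.
Proof.
move=> a0 ab bT.
rewrite /Rintegral integral_indic//= setIidl.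
  rewrite lebesgue_measure_itv/= lte_fin; case: ltgtP ab => // -> _.
  by rewrite subrr.
by apply: subset_itv => //; rewrite bnd_simp.
Qed.

Lemma sqr_step_fun (R : realType) (T : R) (l : seq (R * R * R))
    (n : nat) (t c : nat -> R) :
  step_in T l -> (forall i, t i <= t i.+1) ->
  (forall G : R -> R, \sum_(q <- l) q.1.1 * (G q.2 - G q.1.2) =
        \sum_(0 <= i < n) c i * (G (t i.+1) - G (t i))) ->
  forall x, step_fun l x ^+ 2 = \sum_(0 <= i < n) c i ^+ 2 * \1_`]t i, t i.+1] x.
Proof.
move=> /allP lT tS HG x; rewrite -sqr_sum_disjoint_step//.
rewrite -(HG (fun u => (x <= u)%R%:R)); congr (_ ^+ 2).
apply: eq_big_seq => q /lT /and3P[_ q12 _].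
by rewrite indic_itvoc_leB.
Qed.

Lemma integrable_mul_indic_itvoc (R : realType) (T : R) (k a b : R) :
  lebesgue_measure.-integrable `[0, T] (EFin \o (fun x => k * \1_`]a, b] x)).
Proof.
apply: (@itvcc_bounded_integrable _ _ _ _ `|k|) => //.
- by apply: measurable_funM => //; exact: measurable_funTS.
- move=> x _; rewrite normrM ler_piMr// indicE.
  by case: (_ \in _); rewrite ?normr1 ?normr0.
Qed.

Lemma Rintegral_sqr_step_fun (R : realType) (T : R) (l : seq (R * R * R))
    (n : nat) (t c : nat -> R) :
  step_in T l -> (forall i, t i <= t i.+1) -> 0 <= t 0 -> t n <= T ->
  (forall G : R -> R, \sum_(q <- l) q.1.1 * (G q.2 - G q.1.2) =
        \sum_(0 <= i < n) c i * (G (t i.+1) - G (t i))) ->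
  \int[lebesgue_measure]_(x in `[0, T]) (step_fun l x ^+ 2) =
  \sum_(0 <= i < n) c i ^+ 2 * (t i.+1 - t i).
Proof.
move=> lT tS t0 tnT HG.
have t_mono := homo_leq lexx le_trans tS.
rewrite /Rintegral; transitivity (fine (\int[lebesgue_measure]_(x in `[0%R, T])
    \sum_(i <- index_iota 0 n) (c i ^+ 2 * \1_`]t i, t i.+1] x)%:E)%E).
  congr fine; apply: eq_integral => x _.
  by rewrite (sqr_step_fun lT tS HG) sumEFin.
rewrite integral_sum//; last by move=> i; exact: integrable_mul_indic_itvoc.
rewrite (eq_big_seq (fun i => (c i ^+ 2 * (t i.+1 - t i))%:E)) ?sumEFin//.
move=> i; rewrite mem_index_iota => /andP[_ ni].
rewrite -(@Rintegral_indic_itvoc _ T)//; last 2 first.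
- by rewrite (le_trans t0)// t_mono.
- by rewrite (le_trans _ tnT)// t_mono.
rewrite -RintegralZl//; last first.
  have := @integrable_mul_indic_itvoc _ T 1 (t i) (t i.+1).
  by congr (_.-integrable _ _); apply/funext => x/=; rewrite mul1r.
rewrite fineK//; apply: integrable_fin_num => //.
exact: integrable_mul_indic_itvoc.
Qed.

Lemma integral_prob_cst (R : realType) (d : measure_display)
    (Omega : measurableType d) (P : probability Omega R) (k : R) :
  (\int[P]_w k%:E = k%:E)%E.
Proof. by have := expectation_cst P k; rewrite expectation.unlock. Qed.

Lemma sigma_algebra_measurableE (d : measure_display)
    (Omega : measurableType d) (G : set (set Omega)) (A : set Omega) :
  sigma_algebra setT G -> G.-sigma.-measurable A = G A.
Proof. by move=> sG; rewrite /measurable/= sigma_algebra_id. Qed.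

(** Adaptedness is phrased with preimages in a bare family of sets; this bridge makes the closure
    properties of measurable functions available for each [F t]. *)
Lemma measurable_fun_sigmaP (R : realType) (d : measure_display)
    (Omega : measurableType d) (G : set (set Omega)) (U : Omega -> R) :
  sigma_algebra setT G ->
  (forall A : set R, measurable A -> G (U @^-1` A)) <->
  measurable_fun setT (U : g_sigma_algebraType G -> R).
Proof.
move=> sG; split => [GU _ A mA|mU A mA].
  by rewrite setTI sigma_algebra_measurableE//; exact: GU.
by have := mU measurableT A mA; rewrite setTI sigma_algebra_measurableE.
Qed.

Section brownian.
Context {R : realType} {d : measure_display} {Omega : measurableType d}.
Variables (P : probability Omega R) (T : R) (F : R -> set (set Omega)).
Variable B : R -> Omega -> R.
Hypothesis hF : filtration T F.
Hypothesis hB : brownian_motion P T F B.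

Lemma adapted_measurable (X : R -> Omega -> R) t :
  adapted T F X -> 0 <= t <= T -> measurable_fun setT (X t).
Proof.
move=> aX t0T _ A mA; rewrite setTI.
by have [_ [FP _]] := hF; apply: (FP t t0T); exact: aX.
Qed.

Lemma adapted_sigma (X : R -> Omega -> R) s t :
  adapted T F X -> 0 <= s -> s <= t -> t <= T ->
  measurable_fun setT (X s : g_sigma_algebraType (F t) -> R).
Proof.
move=> aX s0 st tT; have [Fs [_ Fmono]] := hF.
apply/measurable_fun_sigmaP; first by apply: Fs; rewrite tT (le_trans s0).
move=> A mA; apply: (Fmono s t s0 st tT).
by apply: aX => //; rewrite s0 (le_trans st).
Qed.

Lemma brownian_measurable t : 0 <= t <= T -> measurable_fun setT (B t).
Proof. by case: hB => aB _; exact: adapted_measurable. Qed.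

Lemma increment_measurable s t : 0 <= s -> s <= t -> t <= T ->
  measurable_fun setT (increment B s t).
Proof.
move=> s0 st tT; apply: measurable_funB; apply: brownian_measurable.
  by rewrite tT (le_trans s0).
by rewrite s0 (le_trans st).
Qed.

Lemma increment_mgf s t a : 0 <= s -> s <= t -> t <= T ->
  (\int[P]_w (expR (a * increment B s t w))%:E
   = (expR (a ^+ 2 / 2 * (t - s)))%:E)%E.
Proof.
(* [brownian_motion] speaks of [s < t] only. Equal times do occur, since nodes of a partition may
   coincide, and then the increment is zero. *)
move=> s0; rewrite le_eqVlt => /predU1P[<- _|st tT].
  rewrite subrr mulr0 expR0.
  under eq_integral do rewrite /increment subrr mulr0 expR0.
  exact: integral_prob_cst.
have mI := increment_measurable s0 (ltW st) tT.
have ts0 : 0 < t - s by rewrite subr_gt0.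
have <- : (\int[normal_prob 0 (Num.sqrt (t - s))]_x (expR (a * x))%:E
    = (expR (a ^+ 2 / 2 * (t - s)))%:E)%E.
  by rewrite normal_mgf ?sqr_sqrtr ?ltW// gt_eqF// sqrtr_gt0.
pose X : {RV P >-> R} := HB.pack_for {mfun Omega >-> R} (increment B s t)
  (isMeasurableFun.Build _ _ _ _ _ mI).
have mf : measurable_fun setT (fun x : R => (expR (a * x))%:E).
  by apply/measurable_EFinP; apply: measurableT_comp => //; exact: measurable_funM.
pose N := [the probability _ R of normal_prob 0 (Num.sqrt (t - s))].
(* [normal_prob] lives on [measurableTypeR R], whose display differs from that
   of the canonical structure on [R]; the identity transports it. *)
have mid : measurable_fun setT (fun x : measurableTypeR R => x : R).
  by move=> _ A mA; rewrite setTI.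
pose Y : {RV N >-> R} := HB.pack_for {mfun measurableTypeR R >-> R}
  (fun x : measurableTypeR R => x : R) (isMeasurableFun.Build _ _ _ _ _ mid).
transitivity (\int[distribution P X]_x (expR (a * x))%:E)%E.
  by rewrite ge0_integral_distribution// => x; rewrite lee_fin expR_ge0.
transitivity (\int[distribution N Y]_x (expR (a * x))%:E)%E; last first.
  by rewrite ge0_integral_distribution// => x; rewrite lee_fin expR_ge0.
apply: eq_measure_integral => A mA _.
have [_ [_ [_ [+ _]]]] := hB.
by move=> /(_ s t s0 st tT A mA).
Qed.

(** Every event generated by [U] belongs to [F s], and [increment B s t] is independent of [F s].
    This splits off the last increment in [partition_sum_mgf]. *)
Lemma indep_increment_mgf s t (U : Omega -> R) a : 0 <= s -> s <= t -> t <= T ->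
  measurable_fun setT (U : g_sigma_algebraType (F s) -> R) ->
  (\int[P]_w (expR (U w + a * increment B s t w))%:E =
   \int[P]_w (expR (U w))%:E * (expR (a ^+ 2 / 2 * (t - s)))%:E)%E.
Proof.
move=> s0 st tT mUs; rewrite -(increment_mgf a s0 st tT).
have [Fs [FP _]] := hF; have s0T : 0 <= s <= T by rewrite s0 (le_trans st).
have FU := (measurable_fun_sigmaP U (Fs s s0T)).2 mUs.
have mU : measurable_fun setT U.
  by move=> _ A mA; rewrite setTI; apply: (FP s s0T); exact: FU.
move: st; rewrite le_eqVlt => /predU1P[st|st].
  have i0 w : increment B s t w = 0 by rewrite -st /increment subrr.
  rewrite [X in (_ * X)%E](_ : _ = \int[P]_w 1%:E)%E; last first.
    by apply: eq_integral => w _; rewrite i0 mulr0 expR0.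
  rewrite integral_prob_cst mule1.
  by apply: eq_integral => w _; rewrite i0 mulr0 addr0.
under [LHS]eq_integral do rewrite expRD EFinM.
apply: (@indep_ge0_integralM _ _ _ P U (increment B s t)
  (EFin \o expR) (fun x => (expR (a * x))%:E)).
- exact: mU.
- exact: increment_measurable (ltW st) tT.
- move=> A1 A2 mA1 mA2; have [_ [_ [_ [_ ind]]]] := hB.
  by apply: (ind s t) => //; exact: FU.
- by apply/measurable_EFinP; exact: measurable_expR.
- by apply/measurable_EFinP; apply: measurableT_comp => //; exact: measurable_funM.
- by move=> x; rewrite lee_fin expR_ge0.
- by move=> x; rewrite lee_fin expR_ge0.
Qed.

Lemma partition_sum_mgf (n : nat) (t c : nat -> R) :
  (forall i, t i <= t i.+1) -> 0 <= t 0 -> t n <= T ->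
  (\int[P]_w (expR (\sum_(0 <= i < n) c i * increment B (t i) (t i.+1) w))%:E
   = (expR (\sum_(0 <= i < n) c i ^+ 2 / 2 * (t i.+1 - t i)))%:E)%E.
Proof.
move=> tS t0; have t_mono := homo_leq lexx le_trans tS.
elim: n => [_|n IH tT].
  under eq_integral do rewrite big_nil.
  by rewrite big_nil expR0 integral_prob_cst.
have tnT : t n <= T by rewrite (le_trans (tS n)).
rewrite big_nat_recr//= expRD EFinM -IH//.
under eq_integral do rewrite big_nat_recr//=.
apply: indep_increment_mgf => //; first by rewrite (le_trans t0)// t_mono.
have [aB _] := hB.
(* The number of terms is decoupled from the sigma-algebra [F (t n)], which stays fixed during the
   induction on [m]. *)
suff meas m : (m <= n)%N -> measurable_fun setT
    ((fun w => \sum_(0 <= i < m) c i * increment B (t i) (t i.+1) w)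
       : g_sigma_algebraType (F (t n)) -> R) by exact: meas.
elim: m => [_|m IHm mn].
  rewrite (_ : (fun w => _) = cst 0)//.
  by apply/funext => w; rewrite big_nil.
rewrite (_ : (fun w => _) = (fun w =>
    \sum_(0 <= i < m) c i * increment B (t i) (t i.+1) w
    + c m * increment B (t m) (t m.+1) w)); last first.
  by apply/funext => w; rewrite big_nat_recr.
apply: measurable_funD; first by apply: IHm; exact: ltnW.
apply: measurable_funM => //; apply: measurable_funB; apply: adapted_sigma => //.
- by rewrite (le_trans t0)// t_mono.
- by rewrite t_mono.
- by rewrite (le_trans t0)// t_mono.
- by rewrite t_mono// ltnW.
Qed.

Lemma step_integral_mgf (l : seq (R * R * R)) (a : R) : 0 <= T -> step_in T l ->
  (\int[P]_w (expR (a * step_integral B l w))%:E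
   = (expR (a ^+ 2 / 2 *
        \int[lebesgue_measure]_(x in `[0, T]) (step_fun l x ^+ 2)%R))%:E)%E.
Proof.
move=> T0 lT; have [n [t [c [tS t0 tT HG]]]] := step_partition T0 lT.
rewrite (Rintegral_sqr_step_fun lT tS t0 tT HG).
transitivity (\int[P]_w
   (expR (\sum_(0 <= i < n) (a * c i) * increment B (t i) (t i.+1) w))%:E)%E.
  apply: eq_integral => w _; congr (expR _)%:E.
  under eq_bigr do rewrite -mulrA.
  by rewrite -mulr_sumr -(HG (B ^~ w)).
rewrite partition_sum_mgf// mulr_sumr; congr (expR _)%:E.
by apply: eq_bigr => i _; rewrite exprMn; ring.
Qed.

Lemma step_integral_measurable (l : seq (R * R * R)) : step_in T l ->
  measurable_fun setT (step_integral B l).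
Proof.
elim: l => [_|q l IH /= /andP[/and3P[q0 q1 q2] lT]].
  rewrite (_ : step_integral _ _ = cst 0)//.
  by apply/funext => w; rewrite /step_integral big_nil.
rewrite (_ : step_integral _ _ = (fun w =>
    q.1.1 * increment B q.1.2 q.2 w + step_integral B l w)); last first.
  by apply/funext => w; rewrite /step_integral big_cons.
apply: measurable_funD; last exact: IH.
by apply: measurable_funM => //; exact: increment_measurable.
Qed.

End brownian.

(** * Ito integrals of deterministic functions *)

Section integrable_EFin.
Context {R : realType} {d : measure_display} {X : measurableType d}.
Variables (mu : {measure set X -> \bar R}) (D : set X).
Hypothesis mD : measurable D.
Implicit Types f g : X -> R.

Lemma EFin_integrableD f g :
  mu.-integrable D (fun x => (f x)%:E) -> mu.-integrable D (fun x => (g x)%:E) ->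
  mu.-integrable D (fun x => (f x + g x)%:E).
Proof. by move=> fi gi; exact: (integrableD mD fi gi). Qed.

Lemma EFin_integrableB f g :
  mu.-integrable D (fun x => (f x)%:E) -> mu.-integrable D (fun x => (g x)%:E) ->
  mu.-integrable D (fun x => (f x - g x)%:E).
Proof. by move=> fi gi; exact: (integrableB mD fi gi). Qed.

Lemma EFin_integrableZl (k : R) f :
  mu.-integrable D (fun x => (f x)%:E) -> mu.-integrable D (fun x => (k * f x)%:E).
Proof. by move=> fi; exact: (integrableZl mD k fi). Qed.

Lemma EFin_integrableZr (k : R) f :
  mu.-integrable D (fun x => (f x)%:E) -> mu.-integrable D (fun x => (f x * k)%:E).
Proof.
by move=> /(EFin_integrableZl k); under eq_fun do rewrite mulrC.
Qed.

Lemma EFin_le_integrable f g :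
  measurable_fun D f -> (forall x, D x -> `|f x| <= g x) ->
  mu.-integrable D (fun x => (g x)%:E) -> mu.-integrable D (fun x => (f x)%:E).
Proof.
move=> mf fg; apply: le_integrable => //; first exact/measurable_EFinP.
by move=> x Dx; rewrite lee_fin (le_trans (fg _ Dx))// ler_norm.
Qed.

End integrable_EFin.

(** The form in which Young's inequality delivers convergence: [C] may blow up as [e] shrinks,
    because [v] tends to zero after [e] has been fixed. *)
Lemma cvg_of_bound (R : realType) (u v : nat -> R) (l M : R) : 0 <= M ->
  v @ \oo --> 0 ->
  (forall e, 0 < e -> exists C, \forall n \near \oo, `|u n - l| <= e * M + C * v n) ->
  u @ \oo --> l.
Proof.
move=> M0 v0 H; apply/cvgrPdist_le => /= e e0.
have M1 : 0 < M + 1 by rewrite ltr_wpDl.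
have [|C HC] := H (e / 2 / (M + 1)); first by rewrite !divr_gt0.
have C1 : 0 < `|C| + 1 by rewrite ltr_wpDl.
near=> n; rewrite distrC; apply: (@le_trans _ _ (e / 2 / (M + 1) * M + C * v n)).
  by near: n.
rewrite [leRHS](splitr e) lerD//.
  rewrite -[leLHS]mulrA ler_piMr ?divr_ge0 ?(ltW e0)//.
  by rewrite mulrC ler_pdivrMr// mul1r lerDl.
rewrite (le_trans (ler_norm _))// normrM.
have : `|v n| <= e / 2 / (`|C| + 1).
  near: n; move/cvgrPdist_le : v0 => /(_ (e / 2 / (`|C| + 1))).
  rewrite !divr_gt0// => /(_ isT); apply: filterS => n /=.
  by rewrite sub0r normrN.
rewrite ler_pdivlMr//; apply: le_trans.
by rewrite mulrC ler_wpM2l// lerDl.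
Unshelve. all: by end_near. Qed.

Lemma le_norm_Rintegral_diff (R : realType) (d : measure_display)
    (X : measurableType d) (mu : {measure set X -> \bar R}) (D : set X)
    (f g h : X -> R) : measurable D ->
  mu.-integrable D (fun x => (f x)%:E) -> mu.-integrable D (fun x => (g x)%:E) ->
  mu.-integrable D (fun x => (h x)%:E) ->
  (forall x, D x -> `|f x - g x| <= h x) ->
  `|\int[mu]_(x in D) f x - \int[mu]_(x in D) g x| <= \int[mu]_(x in D) h x.
Proof.
move=> mD fi gi hi fgh; rewrite -RintegralB//.
have fgi : mu.-integrable D (EFin \o (fun x => f x - g x)).
  exact: EFin_integrableB.
apply: (le_trans (le_normr_Rintegral _ fgi)) => //.
apply: le_Rintegral => //.
rewrite (_ : _ \o _ = abse \o (EFin \o (fun x => f x - g x)))//.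
exact: integrable_abse.
Qed.

Lemma sqr_integrableB (R : realType) (d : measure_display)
    (X : measurableType d) (mu : {measure set X -> \bar R}) (D : set X)
    (f g : X -> R) : measurable D ->
  measurable_fun D f -> measurable_fun D g ->
  mu.-integrable D (fun x => (f x ^+ 2)%:E) ->
  mu.-integrable D (fun x => (g x ^+ 2)%:E) ->
  mu.-integrable D (fun x => ((f x - g x) ^+ 2)%:E).
Proof.
move=> mD mf mg fi gi.
apply: (@EFin_le_integrable _ _ _ _ _ mD _ (fun x => 2 * f x ^+ 2 + 2 * g x ^+ 2)).
- by apply: measurable_funX; exact: measurable_funB.
- move=> x _; rewrite ger0_norm ?sqr_ge0//.
  by have := sqr_ge0 (f x + g x); lra.
- by apply: EFin_integrableD => //; exact: EFin_integrableZl.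
Qed.

Lemma cvg_fine0 (R : realType) (u : nat -> \bar R) :
  u @ \oo --> 0%E ->
  (\forall n \near \oo, u n \is a fin_num) /\ (fine (u n) @[n --> \oo] --> 0).
Proof. by move=> u0; have [] := (fine_cvgP u 0).1 u0. Qed.

(** Integrates the weighted Young inequality [|b^2 - a^2| <= e a^2 + (1 + 1/e) (a - b)^2], which
    takes the place of the triangle inequality for the [L^2] norm. *)
Lemma cvg_Rintegral_sqr (R : realType) (d : measure_display)
    (X : measurableType d) (mu : {measure set X -> \bar R}) (D : set X)
    (f : X -> R) (g : nat -> X -> R) : measurable D ->
  measurable_fun D f -> (forall n, measurable_fun D (g n)) ->
  mu.-integrable D (fun x => (f x ^+ 2)%:E) ->
  (forall n, mu.-integrable D (fun x => (g n x ^+ 2)%:E)) ->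
  (\int[mu]_(x in D) ((f x - g n x) ^+ 2)%:E)%E @[n --> \oo] --> 0%E ->
  \int[mu]_(x in D) (g n x ^+ 2) @[n --> \oo] --> \int[mu]_(x in D) (f x ^+ 2).
Proof.
move=> mD mf mg fi gi /cvg_fine0[_ fg0].
apply: (cvg_of_bound (M := \int[mu]_(x in D) (f x ^+ 2)) _ fg0).
  by apply: Rintegral_ge0 => x _; exact: sqr_ge0.
move=> e e0; exists (1 + e^-1); apply: nearW => n.
have fgi := sqr_integrableB mD mf (mg n) fi (gi n).
have efi : mu.-integrable D (fun x => (e * f x ^+ 2)%:E).
  exact: EFin_integrableZl.
have efgi : mu.-integrable D (fun x => ((1 + e^-1) * (f x - g n x) ^+ 2)%:E).
  exact: EFin_integrableZl.
rewrite -[X in _ <= X + _]RintegralZl//.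
rewrite -[X in _ <= _ + _ * X]/(\int[mu]_(x in D) ((f x - g n x) ^+ 2)).
rewrite -[X in _ <= _ + X]RintegralZl// -RintegralD//.
apply: le_norm_Rintegral_diff => //.
  exact: EFin_integrableD.
move=> x _; set a := f x; set b := g n x.
have -> : b ^+ 2 - a ^+ 2 = (a - b) ^+ 2 + 2 * a * (b - a) by ring.
rewrite (le_trans (ler_normD _ _))// ger0_norm ?sqr_ge0//.
have -> : e * a ^+ 2 + (1 + e^-1) * (a - b) ^+ 2
    = (a - b) ^+ 2 + (e * a ^+ 2 + e^-1 * (a - b) ^+ 2) by ring.
rewrite lerD2l ler_norml.
have e10 : 0 < e^-1 by rewrite invr_gt0.
have -> : e * a ^+ 2 + e^-1 * (a - b) ^+ 2
    = e^-1 * (e * a + (a - b)) ^+ 2 - 2 * a * (a - b).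
  by field; rewrite gt_eqF.
have : 0 <= e^-1 * (e * a + (a - b)) ^+ 2 by rewrite mulr_ge0 ?sqr_ge0// ltW.
have : 0 <= e^-1 * (e * a - (a - b)) ^+ 2 by rewrite mulr_ge0 ?sqr_ge0// ltW.
have -> : e^-1 * (e * a - (a - b)) ^+ 2
    = e^-1 * (e * a + (a - b)) ^+ 2 - 4 * a * (a - b).
  by field; rewrite gt_eqF.
move=> h1 h2; apply/andP; split; lra.
Qed.

Lemma expR_lipschitz_le (R : realType) (p q k : R) : p <= k -> q <= k ->
  `|expR p - expR q| <= expR k * `|p - q|.
Proof.
wlog qp : p q / q <= p.
  move=> H pk qk; have [qp|/ltW pq] := leP q p; first exact: H.
  by rewrite distrC [X in _ * X]distrC; exact: H.
move=> pk _; rewrite !ger0_norm ?subr_ge0 ?ler_expR//.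
apply: (@le_trans _ _ (expR p * (p - q))); last first.
  by rewrite ler_wpM2r ?subr_ge0// ler_expR.
have -> : expR q = expR p * expR (q - p) by rewrite -expRD addrC subrK.
rewrite -[X in X - _]mulr1 -mulrBr ler_wpM2l ?expR_ge0//.
have := expR_ge1Dx (q - p); lra.
Qed.

Lemma minr_lipschitz (R : realType) (x y k : R) :
  `|Num.min x k - Num.min y k| <= `|x - y|.
Proof.
have h1 := ler_norm (x - y); have h2 := ler_norm (y - x).
rewrite distrC in h2; rewrite ler_norml.
by case: (leP x k) => ?; case: (leP y k) => ?; apply/andP; split; lra.
Qed.

(** The truncated exponential is Lipschitz with constant [L = expR k * |a|], and
    [L q <= e + L^2 q^2 / e] bounds the error directly by the squared distance. *)
Lemma cvg_truncated_mgf (R : realType) (d : measure_display)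
    (Omega : measurableType d) (P : probability Omega R)
    (Y_ : nat -> Omega -> R) (Y : Omega -> R) (a k : R) :
  (forall n, measurable_fun setT (Y_ n)) -> measurable_fun setT Y ->
  (\int[P]_w ((Y w - Y_ n w) ^+ 2)%:E)%E @[n --> \oo] --> 0%E ->
  \int[P]_w expR (Num.min (a * Y_ n w) k) @[n --> \oo] -->
  \int[P]_w expR (Num.min (a * Y w) k).
Proof.
move=> mY_ mY /cvg_fine0[finY Y0]; apply: (cvg_of_bound ler01 Y0) => e e0.
pose L := expR k * `|a|.
exists (e^-1 * L ^+ 2); near=> n.
have itr (Z : Omega -> R) : measurable_fun setT Z ->
    P.-integrable setT (fun w => (expR (Num.min (a * Z w) k))%:E).
  move=> mZ; apply: (@le_bounded_integrable _ _ _ _ _ _ (expR k)) => //.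
  - exact: fin_num_fun_lty.
  - apply: measurableT_comp => //; apply: measurable_minr => //.
    exact: measurable_funM.
  - by move=> w _; rewrite ger0_norm ?expR_ge0// ler_expR ge_min lexx orbT.
have mYY : measurable_fun setT (fun w => (Y w - Y_ n w) ^+ 2).
  by apply: measurable_funX; exact: measurable_funB.
(* Finiteness of this integral is known only for large [n], from the convergence to zero in the
   extended reals. *)
have iYY : P.-integrable setT (fun w => ((Y w - Y_ n w) ^+ 2)%:E).
  apply/integrableP; split; first exact/measurable_EFinP.
  under eq_integral do rewrite gee0_abs ?lee_fin ?sqr_ge0//.
  rewrite -ge0_fin_numE; last by apply: integral_ge0 => w _; rewrite lee_fin sqr_ge0.
  by near: n.
have icst : P.-integrable setT (fun=> e%:E).
  exact: finite_measure_integrable_cst.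
have -> : e * 1 + e^-1 * L ^+ 2 * fine (\int[P]_w ((Y w - Y_ n w) ^+ 2)%:E)%E
    = \int[P]_w (e + e^-1 * L ^+ 2 * (Y w - Y_ n w) ^+ 2).
  rewrite RintegralD//; last exact: EFin_integrableZl.
  by rewrite RintegralZl// /Rintegral [in RHS]integral_prob_cst mulr1.
apply: le_norm_Rintegral_diff => //; first exact: itr; first exact: itr.
  by apply: EFin_integrableD => //; exact: EFin_integrableZl.
move=> w _; set y := Y w; set z := Y_ n w.
have L0 : 0 <= L by rewrite mulr_ge0 ?expR_ge0.
apply: (@le_trans _ _ (L * `|y - z|)).
  apply: (@le_trans _ _ (expR k * `|Num.min (a * z) k - Num.min (a * y) k|)).
    by apply: expR_lipschitz_le; rewrite ge_min lexx orbT.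
  rewrite /L -mulrA ler_wpM2l ?expR_ge0// (le_trans (minr_lipschitz _ _ _))//.
  by rewrite -mulrBr normrM distrC.
rewrite -(real_normK (num_real (y - z))); set q := `|y - z|.
have : 0 <= e^-1 * (L * q - e) ^+ 2 by rewrite mulr_ge0 ?sqr_ge0// invr_ge0 ltW.
have -> : e^-1 * (L * q - e) ^+ 2 = e + e^-1 * L ^+ 2 * q ^+ 2 - 2 * (L * q).
  by field; rewrite gt_eqF.
have : 0 <= L * q by rewrite mulr_ge0 ?normr_ge0.
lra.
Unshelve. all: by end_near. Qed.

Lemma sqr_addr_le (R : realType) (x y : R) : (x + y) ^+ 2 <= 2 * x ^+ 2 + 2 * y ^+ 2.
Proof. by have := sqr_ge0 (x - y); lra. Qed.

(** The measure is arbitrary so that the lemma serves both halves of [is_ito_integral]: the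
    integrands under Lebesgue measure and the integrals under [P]. *)
Lemma cvg_integral_sqr_lin (R : realType) (d : measure_display)
    (X : measurableType d) (mu : {measure set X -> \bar R}) (D : set X)
    (f g : X -> R) (f_ g_ : nat -> X -> R) (a b : R) : measurable D ->
  measurable_fun D f -> measurable_fun D g ->
  (forall n, measurable_fun D (f_ n)) -> (forall n, measurable_fun D (g_ n)) ->
  (\int[mu]_(x in D) ((f x - f_ n x) ^+ 2)%:E)%E @[n --> \oo] --> 0%E ->
  (\int[mu]_(x in D) ((g x - g_ n x) ^+ 2)%:E)%E @[n --> \oo] --> 0%E ->
  (\int[mu]_(x in D)
     ((a * f x + b * g x - (a * f_ n x + b * g_ n x)) ^+ 2)%:E)%E
    @[n --> \oo] --> 0%E.
Proof.
move=> mD mf mg mf_ mg_ f0 g0.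
pose U n := (\int[mu]_(x in D) ((f x - f_ n x) ^+ 2)%:E)%E.
pose V n := (\int[mu]_(x in D) ((g x - g_ n x) ^+ 2)%:E)%E.
pose A := 2 * a ^+ 2; pose C := 2 * b ^+ 2.
have A0 : 0 <= A by rewrite mulr_ge0 ?sqr_ge0.
have C0 : 0 <= C by rewrite mulr_ge0 ?sqr_ge0.
have UV0 : (A%:E * U n + C%:E * V n)%E @[n --> \oo] --> 0%E.
  have AU : (A%:E * U n)%E @[n --> \oo] --> 0%E.
    by rewrite -[X in _ --> X](mule0 A%:E); exact: cvgeZl.
  have CV : (C%:E * V n)%E @[n --> \oo] --> 0%E.
    by rewrite -[X in _ --> X](mule0 C%:E); exact: cvgeZl.
  by rewrite -[X in _ --> X]adde0; exact: cvgeD.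
apply: (@squeeze_cvge _ _ _ _ (cst 0%E) _ (fun n => A%:E * U n + C%:E * V n)%E) => //;
  last exact: cvg_cst.
apply: nearW => n; apply/andP; split.
  by apply: integral_ge0 => x _; rewrite lee_fin sqr_ge0.
have mU : measurable_fun D (fun x => ((f x - f_ n x) ^+ 2)%:E).
  by apply/measurable_EFinP; apply: measurable_funX; exact: measurable_funB.
have mV : measurable_fun D (fun x => ((g x - g_ n x) ^+ 2)%:E).
  by apply/measurable_EFinP; apply: measurable_funX; exact: measurable_funB.
rewrite -ge0_integralZl//; last by move=> x _; rewrite lee_fin sqr_ge0.
rewrite -ge0_integralZl//; last by move=> x _; rewrite lee_fin sqr_ge0.
rewrite -ge0_integralD//; first last.
- exact: measurable_funeM.
- by move=> x _; rewrite -EFinM lee_fin mulr_ge0 ?sqr_ge0.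
- exact: measurable_funeM.
- by move=> x _; rewrite -EFinM lee_fin mulr_ge0 ?sqr_ge0.
apply: ge0_le_integral => //.
- by move=> x _; rewrite lee_fin sqr_ge0.
- apply/measurable_EFinP; apply: measurable_funX; apply: measurable_funB;
    by apply: measurable_funD; exact: measurable_funM.
- by apply: emeasurable_funD; exact: measurable_funeM.
- move=> x _; rewrite -!EFinM -EFinD lee_fin /A /C.
  have -> : a * f x + b * g x - (a * f_ n x + b * g_ n x)
    = a * (f x - f_ n x) + b * (g x - g_ n x) by ring.
  rewrite (le_trans (sqr_addr_le _ _))// !exprMn; lra.
Qed.

(** Overlapping intervals being allowed, concatenation of lists is addition of step functions; with
    this scaling, lists represent all linear combinations. *)
Definition step_scale (R : realType) (a : R) (l : seq (R * R * R)) :=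
  [seq (a * q.1.1, q.1.2, q.2) | q <- l].

Section step.
Context {R : realType}.
Implicit Types (l : seq (R * R * R)) (t a : R).

Lemma step_fun_lin a b l1 l2 x :
  step_fun (step_scale a l1 ++ step_scale b l2) x =
  a * step_fun l1 x + b * step_fun l2 x.
Proof.
rewrite /step_fun big_cat !big_map !mulr_sumr/=.
by congr (_ + _); apply: eq_bigr => q _; rewrite mulrA.
Qed.

Lemma step_integral_lin (d : measure_display) (W : measurableType d)
    (B : R -> W -> R) a b l1 l2 w :
  step_integral B (step_scale a l1 ++ step_scale b l2) w =
  a * step_integral B l1 w + b * step_integral B l2 w.
Proof.
rewrite /step_integral big_cat !big_map !mulr_sumr/=.
by congr (_ + _); apply: eq_bigr => q _; rewrite mulrA.
Qed.

Lemma step_in_lin t a b l1 l2 : step_in t l1 -> step_in t l2 ->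
  step_in t (step_scale a l1 ++ step_scale b l2).
Proof. by move=> h1 h2; rewrite /step_in all_cat !all_map; apply/andP. Qed.

Lemma step_inW t u l : t <= u -> step_in t l -> step_in u l.
Proof.
move=> tu; apply: sub_all => q /and3P[q0 q1 q2].
by rewrite q0 q1 (le_trans q2).
Qed.

Lemma step_fun_out t l x : step_in t l -> t < x -> step_fun l x = 0.
Proof.
move=> /allP lt tx; rewrite /step_fun big_seq big1// => q /lt /and3P[_ _ qt].
rewrite indicE memNset ?mulr0//= in_itv/= => /andP[_].
by rewrite leNgt (le_lt_trans qt).
Qed.

Lemma step_fun_measurable l (D : set R) : measurable_fun D (step_fun l).
Proof.
apply: measurable_funTS; elim: l => [|q l IH].
  rewrite (_ : step_fun _ = cst 0)//.
  by apply/funext => w; rewrite /step_fun big_nil.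
rewrite (_ : step_fun _ = (fun x => q.1.1 * \1_`]q.1.2, q.2] x + step_fun l x)).
  by apply: measurable_funD => //; exact: measurable_funM.
by apply/funext => w; rewrite /step_fun big_cons.
Qed.

Lemma step_fun_bound l x : `|step_fun l x| <= \sum_(q <- l) `|q.1.1|.
Proof.
apply: (le_trans (ler_norm_sum _ _ _)); apply: ler_sum => q _.
by rewrite normrM ler_piMr// indicE; case: (_ \in _); rewrite ?normr1 ?normr0.
Qed.

Lemma step_fun_sqr_integrable l (T : R) :
  lebesgue_measure.-integrable `[0, T] (fun x => (step_fun l x ^+ 2)%:E).
Proof.
apply: (@itvcc_bounded_integrable _ _ _ _ ((\sum_(q <- l) `|q.1.1|) ^+ 2)).
  by apply: measurable_funX; exact: step_fun_measurable.
by move=> x _; rewrite normrX lerXn2r ?nnegrE ?step_fun_bound// sumr_ge0.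
Qed.

End step.

Section ito.
Context {R : realType} {d : measure_display} {Omega : measurableType d}.
Variables (P : probability Omega R) (T : R) (F : R -> set (set Omega)).
Variable B : R -> Omega -> R.
Hypothesis hF : filtration T F.
Hypothesis hB : brownian_motion P T F B.

Lemma ito_lin t (f g : R -> R) (Y Z : Omega -> R) a b : t <= T ->
  measurable_fun `[0, t] f -> measurable_fun `[0, t] g ->
  is_ito_integral P B f t Y -> is_ito_integral P B g t Z ->
  is_ito_integral P B (fun x => a * f x + b * g x) t (fun w => a * Y w + b * Z w).
Proof.
move=> tT mf mg [mY [l [lt [lf lY]]]] [mZ [k [kt [kg kZ]]]].
split; first by apply: measurable_funD => //; exact: measurable_funM.
exists (fun n => step_scale a (l n) ++ step_scale b (k n)); split; [|split].
- by move=> n; exact: step_in_lin.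
- under eq_fun do under eq_integral do rewrite step_fun_lin.
  by apply: cvg_integral_sqr_lin => // n; exact: step_fun_measurable.
- rewrite unlock in lY kZ *.
  under eq_fun do under eq_integral do rewrite step_integral_lin.
  apply: cvg_integral_sqr_lin => // n; apply: (step_integral_measurable hF hB).
    exact: step_inW (lt n).
  exact: step_inW (kt n).
Qed.

(** The approximating step functions live on [[0, t]] and vanish beyond [t], so the same sequence
    works on [[0, T]]. Values of the integral process at different times thereby become integrals
    over one common interval. *)
Lemma ito_restrict t (f : R -> R) (Y : Omega -> R) : t <= T ->
  is_ito_integral P B f t Y ->
  is_ito_integral P B (fun x => f x * (x <= t)%R%:R) T Y.
Proof.
move=> tT [mY [l [lt [lf lY]]]]; split => //; exists l; split; [|split => //].
  by move=> n; exact: step_inW (lt n).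
suff <- : (fun n => \int[lebesgue_measure]_(x in `[0%R, t])
    ((f x - step_fun (l n) x) ^+ 2)%:E)%E = (fun n =>
    \int[lebesgue_measure]_(x in `[0%R, T])
    ((f x * (x <= t)%R%:R - step_fun (l n) x) ^+ 2)%:E)%E by [].
apply/funext => n.
rewrite integral_mkcond [RHS]integral_mkcond; apply: eq_integral => x _.
rewrite !patchE !mem_setE !in_itv/=.
have [x0|x0] := leP 0 x => //=; have [xt|tx] := leP x t.
  by rewrite (le_trans xt tT) mulr1.
by rewrite mulr0 (step_fun_out (lt n) tx) subrr expr0n/=; case: ifP.
Qed.

Lemma ito_mgf (f : R -> R) (Y : Omega -> R) (a : R) : 0 <= T ->
  measurable_fun `[0, T] f ->
  lebesgue_measure.-integrable `[0, T] (fun x => (f x ^+ 2)%:E) ->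
  is_ito_integral P B f T Y ->
  (\int[P]_w (expR (a * Y w))%:E = (expR (a ^+ 2 / 2 *
     \int[lebesgue_measure]_(x in `[0, T]) (f x ^+ 2)%R))%:E)%E.
Proof.
move=> T0 mf fi [mY [l [lt [lf lY]]]]; move: a.
apply: (@mgf_lim _ _ _ P (fun n => step_integral B (l n)) Y
  (fun n => \int[lebesgue_measure]_(x in `[0, T]) (step_fun (l n) x ^+ 2))) => //.
- by move=> n; exact: (step_integral_measurable hF hB).
- by move=> n a; rewrite (step_integral_mgf hF hB).
- apply: cvg_Rintegral_sqr => //.
  + by move=> n; exact: step_fun_measurable.
  + by move=> n; exact: step_fun_sqr_integrable.
- move=> a k; apply: cvg_truncated_mgf => //.
    by move=> n; exact: (step_integral_measurable hF hB).
  by move: lY; rewrite unlock.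
Qed.

End ito.

(** * Riemann sums for exponential weights *)

(** Heine-Cantor: halving the continuity radius at each point leaves room for both the centre and
    the second point to move. *)
Lemma uniformly_continuous_itvcc (R : realType) (a b : R) (m : R -> R) :
  {within `[a, b], continuous m} -> forall e, 0 < e ->
  exists2 d, 0 < d & forall x y, a <= x <= b -> a <= y <= b ->
    `|x - y| < d -> `|m x - m y| <= e.
Proof.
move=> /subspace_continuousP cm e e0.
pose Q (d x : R) := forall y, a <= y <= b -> `|x - y| < d -> `|m x - m y| <= e.
have : near_covering_within `[a, b].
  by apply/near_covering_withinP/compact_near_coveringP; exact: segment_compact.
move=> /(_ R (0^'+) Q _)[x abx|].
  have := cm x abx => /cvgrPdist_lt /(_ (e / 2)).
  rewrite divr_gt0// => /(_ isT); rewrite near_withinE => -[/= eta eta0 H].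
  exists (ball x (eta / 2), [set d | 0 < d < eta / 2]) => /=.
    split; first by exists (eta / 2) => //=; rewrite divr_gt0.
    exists (eta / 2); first by rewrite /= divr_gt0.
    move=> z/=; rewrite sub0r normrN => h1 h2.
    by rewrite h2 (le_lt_trans (ler_norm _) h1).
  move=> [x' d]/= [xx' /andP[d0 deta]] abx' y aby x'y.
  have h z : a <= z <= b -> `|x - z| < eta -> `|m x - m z| < e / 2.
    by move=> abz xz; apply: H => //=; rewrite in_itv.
  have h1 : `|m x - m x'| < e / 2.
    by apply: h => //; rewrite (lt_trans xx')// ltr_pdivrMr// ltr_pMr// ltr1n.
  have h2 : `|m x - m y| < e / 2.
    apply: h => //; rewrite -(subrKA x') (le_lt_trans (ler_normD _ _))//.
    by rewrite [ltRHS]splitr ltrD// (lt_trans x'y).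
  rewrite -(subrKA (m x)) (le_trans (ler_normD _ _))// [leRHS]splitr.
  by rewrite lerD 1?ltW// distrC.
move=> /= d0 d0gt H.
exists (d0 / 2); first by rewrite divr_gt0.
move=> x y abx aby xy; apply: (H (d0 / 2)) => //=.
- by rewrite sub0r normrN gtr0_norm ?divr_gt0// ltr_pdivrMr// ltr_pMr// ltr1n.
- by rewrite divr_gt0.
Qed.

Lemma continuous_expR_lin (R : realType) (c : R) :
  continuous (fun s : R => expR (c * s)).
Proof.
move=> x; apply: continuous_comp; last exact: continuous_expR.
exact: mulrl_continuous.
Qed.

Lemma Rintegral_expR (R : realType) (c a b : R) : a <= b ->
  \int[lebesgue_measure]_(s in `[a, b]) (c * expR (c * s))
  = expR (c * b) - expR (c * a).
Proof.
rewrite le_eqVlt => /predU1P[->|ab].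
  by rewrite set_itv1 Rintegral_set1 subrr.
have dE (x : R) : is_derive x 1 (fun s : R => expR (c * s)) (c * expR (c * x)).
  have -> : c * expR (c * x) = expR (c * x) * c by rewrite mulrC.
  apply: (@is_derive1_comp _ expR (fun s => c * s)).
  by apply: is_derive_eq; rewrite /GRing.scale/= mulr1.
rewrite /Rintegral (@continuous_FTC2 _ _ (fun s => expR (c * s)))//.
- apply: continuous_subspaceT => x; apply: cvgMl_tmp; exact: continuous_expR_lin.
- split.
  + by move=> x _; apply: ex_derive.
  + by apply: cvg_at_right_filter; exact: continuous_expR_lin.
  + by apply: cvg_at_left_filter; exact: continuous_expR_lin.
- by move=> x _; rewrite derive1E; apply: derive_val.
Qed.

Lemma continuous_expR_rev (R : realType) (c T : R) :
  continuous (fun s : R => expR (c * (T - s))).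
Proof.
move=> x; rewrite (_ : (fun s => _) = (fun s => expR (c * T) * expR (- c * s))).
  by apply: cvgMl_tmp; exact: continuous_expR_lin.
by apply/funext => s; rewrite -expRD; congr expR; ring.
Qed.

Lemma continuous_itvcc_integrable (R : realType) (a b : R) (f : R -> R) :
  {within `[a, b], continuous f} ->
  lebesgue_measure.-integrable `[a, b] (fun x => (f x)%:E).
Proof.
by move=> cf; apply: continuous_compact_integrable => //; exact: segment_compact.
Qed.

Lemma itvcc_le_integrable (R : realType) (a b : R) (f g : R -> R) :
  measurable_fun `[a, b] f -> (forall x, a <= x <= b -> `|f x| <= g x) ->
  lebesgue_measure.-integrable `[a, b] (fun x => (g x)%:E) ->
  lebesgue_measure.-integrable `[a, b] (fun x => (f x)%:E).
Proof.
by move=> mf fg; apply: EFin_le_integrable.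
Qed.

Lemma expR_rev_integrable (R : realType) (c T a b : R) :
  lebesgue_measure.-integrable `[a, b] (fun s => (expR (c * (T - s)))%:E).
Proof.
by apply: continuous_itvcc_integrable; apply: continuous_subspaceT;
  exact: continuous_expR_rev.
Qed.

Lemma Rintegral_expR_rev (R : realType) (c T a b : R) : a <= b ->
  \int[lebesgue_measure]_(s in `[a, b]) (c * expR (c * (T - s)))
  = expR (c * (T - a)) - expR (c * (T - b)).
Proof.
move=> ab.
have E (s : R) : expR (c * (T - s)) = expR (c * T) * expR (- c * s).
  by rewrite -expRD; congr expR; ring.
transitivity (\int[lebesgue_measure]_(s in `[a, b])
    (- expR (c * T) * (- c * expR (- c * s)))).
  by apply: eq_Rintegral => s _; rewrite E; ring.
rewrite RintegralZl// ?Rintegral_expR// ?E; last first.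
  apply: continuous_itvcc_integrable; apply: continuous_subspaceT => x.
  by apply: cvgMl_tmp; exact: continuous_expR_lin.
by ring.
Qed.

(** Each cell weight is the exact integral of [r * expR (r * (T - s))] over the cell, so the error
    comes only from the oscillation of [m], and the weights add up to [expR (r * T) - 1]. The
    induction proves the same estimate on [[0, t k]]. *)
Lemma le_stieltjes_sum_expR (R : realType) (r T e d : R) (m : R -> R)
    (t : nat -> R) (n : nat) :
  0 <= r -> {within `[0, T], continuous m} ->
  (forall x y, 0 <= x <= T -> 0 <= y <= T -> `|x - y| < d -> `|m x - m y| <= e) ->
  (forall k, t k <= t k.+1 < t k + d) -> t 0 = 0 -> t n = T ->
  `|\sum_(0 <= k < n) (expR (r * (T - t k)) - expR (r * (T - t k.+1))) * m (t k.+1)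
    - \int[lebesgue_measure]_(s in `[0, T]) (r * expR (r * (T - s)) * m s)|
  <= e * (expR (r * T) - 1).
Proof.
move=> r0 cm md tS t0 tnT.
have t_mono : {homo t : i j / (i <= j)%N >-> i <= j}.
  by apply: (homo_leq lexx le_trans) => i; have /andP[] := tS i.
have cW : continuous (fun s : R => r * expR (r * (T - s))).
  by move=> x; apply: cvgMl_tmp; exact: continuous_expR_rev.
have cG : {within `[0, T], continuous (fun s => r * expR (r * (T - s)) * m s)}.
  move=> x; apply: cvgM; last exact: cm.
  by have := @continuous_subspaceT _ _ `[0, T] _ cW; apply.
have iG := continuous_itvcc_integrable cG.
suff H k : (k <= n)%N ->
  `|\sum_(0 <= j < k) (expR (r * (T - t j)) - expR (r * (T - t j.+1))) * m (t j.+1)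
    - \int[lebesgue_measure]_(s in `[0, t k]) (r * expR (r * (T - s)) * m s)|
  <= e * (expR (r * T) - expR (r * (T - t k))).
  by have := H n (leqnn n); rewrite tnT subrr mulr0 expR0.
elim: k => [_|k IH kn].
  by rewrite big_nil t0 set_itv1 Rintegral_set1 !subr0 normr0 subrr mulr0.
have /andP[tk tkd] := tS k.
have tk0 : 0 <= t k by rewrite -t0 t_mono.
have tkT : t k.+1 <= T by rewrite -tnT t_mono.
have sub : `[t k, t k.+1] `<=` `[0, T] by apply: subset_itv; rewrite bnd_simp.
have iGk : lebesgue_measure.-integrable `[0, t k.+1]
    (fun s => (r * expR (r * (T - s)) * m s)%:E).
  by apply: integrableS iG => //; apply: subset_itvl; rewrite bnd_simp.
have iGk' : lebesgue_measure.-integrable `[t k, t k.+1]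
    (fun s => (r * expR (r * (T - s)) * m s)%:E).
  exact: integrableS iG.
have : \int[lebesgue_measure]_(s in `[0, t k.+1]) (r * expR (r * (T - s)) * m s) =
    \int[lebesgue_measure]_(s in `[0, t k]) (r * expR (r * (T - s)) * m s) +
    \int[lebesgue_measure]_(s in `[t k, t k.+1]) (r * expR (r * (T - s)) * m s).
  have /= := @Rintegral_itvB R _ _ _ (t k) iGk; rewrite !bnd_simp => /(_ tk0 tk).
  rewrite (@Rintegral_itv_obnd_cbnd _ (t k)); first by move=> <-; rewrite addrC subrK.
  by apply: integrableS iGk' => //; apply: subset_itv; rewrite bnd_simp.
move=> ->; rewrite big_nat_recr//= opprD addrACA.
have iW : lebesgue_measure.-integrable `[t k, t k.+1]
    (fun s => (r * expR (r * (T - s)))%:E).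
  by apply: continuous_itvcc_integrable; exact: continuous_subspaceT.
have step : `|(expR (r * (T - t k)) - expR (r * (T - t k.+1))) * m (t k.+1)
    - \int[lebesgue_measure]_(s in `[t k, t k.+1]) (r * expR (r * (T - s)) * m s)|
  <= e * (expR (r * (T - t k)) - expR (r * (T - t k.+1))).
  rewrite -Rintegral_expR_rev// -RintegralZr// -RintegralZl//.
  apply: le_norm_Rintegral_diff => //.
  - exact: EFin_integrableZr.
  - exact: EFin_integrableZl.
  - move=> s /=; rewrite in_itv/= => /andP[s1 s2].
    rewrite -mulrBr normrM ger0_norm ?mulr_ge0 ?expR_ge0// mulrC.
    rewrite ler_wpM2r ?mulr_ge0 ?expR_ge0//; apply: md.
    + by rewrite tkT (le_trans tk0).
    + by rewrite (le_trans tk0)//= (le_trans s2).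
    + by rewrite ger0_norm ?subr_ge0// ltrBlDr (lt_le_trans tkd)// addrC lerD2l.
apply: (le_trans (ler_normD _ _)).
apply: (le_trans (lerD (IH (ltnW kn)) step)).
by rewrite -mulrDr addrA subrK.
Qed.

(** The almost sure counterpart of [cvg_truncated_mgf], used for the Riemann sums, which converge
    path by path: the truncation level [expR k] is a dominating constant. *)
Lemma cvg_truncated_mgf_ae (R : realType) (d : measure_display)
    (Omega : measurableType d) (P : probability Omega R)
    (Y_ : nat -> Omega -> R) (Y : Omega -> R) (a k : R) :
  (forall n, measurable_fun setT (Y_ n)) -> measurable_fun setT Y ->
  {ae P, forall w, Y_ ^~ w @ \oo --> Y w} ->
  \int[P]_w expR (Num.min (a * Y_ n w) k) @[n --> \oo] -->
  \int[P]_w expR (Num.min (a * Y w) k).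
Proof.
move=> mY_ mY Y_Y.
have mtr (Z : Omega -> R) : measurable_fun setT Z ->
    measurable_fun setT (fun w => (expR (Num.min (a * Z w) k))%:E).
  move=> mZ; apply/measurable_EFinP; apply: measurableT_comp => //.
  by apply: measurable_minr => //; exact: measurable_funM.
have cvg_tr : {ae P, forall w, setT w ->
    (expR (Num.min (a * Y_ n w) k))%:E @[n --> \oo] -->
    (expR (Num.min (a * Y w) k))%:E}.
  apply: filterS Y_Y => w Yw _; apply: cvg_EFin; first exact: nearW.
  apply: (@continuous_cvg _ _ _ _ _ _ expR); first exact: continuous_expR.
  apply: (@continuous_cvg _ _ _ _ _ _ (fun z => Num.min (a * z) k)) => //.
  apply: continuous_min; last exact: cst_continuous.
  exact: mulrl_continuous.
have bnd : {ae P, forall w n, setT w ->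
    (`|(expR (Num.min (a * Y_ n w) k))%:E| <= (expR k)%:E)%E}.
  apply: aeW => w n _; rewrite lee_fin ger0_norm ?expR_ge0// ler_expR.
  by rewrite ge_min lexx orbT.
have icst : P.-integrable setT (fun=> (expR k)%:E).
  exact: finite_measure_integrable_cst.
have [iY _ cvgI] := dominated_convergence measurableT
  (fun n => mtr _ (mY_ n)) (mtr _ mY) cvg_tr icst bnd.
by apply: fine_cvg; rewrite fineK; [exact: cvgI|exact: integrable_fin_num].
Qed.

(** Index [n] stands for [n.+1] cells, so that every index yields a partition. Nodes with [k > n.+1]
    leave [[0, T]] when [0 < T]. *)
Definition unif_part (R : realType) (T : R) (n k : nat) : R :=
  k%:R * (T / n.+1%:R).

Section unif_part.
Context {R : realType}.
Variable T : R.
Hypothesis T0 : 0 < T.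
Local Notation t n := (unif_part T n).

Lemma unif_part_step n k : t n k <= t n k.+1 <= t n k + T / n.+1%:R.
Proof.
rewrite /unif_part -[k.+1]addn1 natrD mulrDl mul1r lexx andbT lerDl.
by rewrite divr_ge0// ltW.
Qed.

Lemma unif_part0 n : t n 0 = 0.
Proof. by rewrite /unif_part mul0r. Qed.

Lemma unif_part_end n : t n n.+1 = T.
Proof. by rewrite /unif_part mulrCA divff ?mulr1. Qed.

Lemma unif_part_in n k : (k <= n.+1)%N -> 0 <= t n k <= T.
Proof.
have mono : {homo t n : i j / (i <= j)%N >-> i <= j}.
  by apply: (homo_leq lexx le_trans) => i; have /andP[] := unif_part_step n i.
move=> kn; rewrite -[X in X <= _ <= _](unif_part0 n).
by rewrite -[X in _ <= _ <= X](unif_part_end n) !mono.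
Qed.

Lemma cvg_stieltjes_sum_expR (r : R) (m : R -> R) : 0 <= r ->
  {within `[0, T], continuous m} ->
  \sum_(0 <= k < n.+1)
    (expR (r * (T - t n k)) - expR (r * (T - t n k.+1))) * m (t n k.+1)
  @[n --> \oo] -->
  \int[lebesgue_measure]_(s in `[0, T]) (r * expR (r * (T - s)) * m s).
Proof.
move=> r0 cm; apply/cvgrPdist_le => /= e e0.
(* The tolerance is divided by [expR (r * T)] to absorb the total weight [expR (r * T) - 1]. *)
have [|d d0 md] := uniformly_continuous_itvcc cm (e := e / expR (r * T)).
  by rewrite divr_gt0 ?expR_gt0.
have dT : 0 < d / T by rewrite divr_gt0.
near=> n; rewrite distrC.
apply: (@le_trans _ _ (e / expR (r * T) * (expR (r * T) - 1))).
  apply: (@le_stieltjes_sum_expR _ r T _ d) => //.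
  - move=> k; have /andP[-> h] := unif_part_step n k.
    rewrite (le_lt_trans h)// ltrD2l mulrC -ltr_pdivlMr//.
    by near: n; exact: (near_infty_natSinv_lt (PosNum dT)).
  - exact: unif_part0.
  - exact: unif_part_end.
rewrite -mulrA ler_piMr ?(ltW e0)// mulrBr mulVf ?gt_eqF ?expR_gt0// mulr1.
Unshelve. all: by end_near. Qed.

End unif_part.

(** The middle term multiplies the integrand once the time integral of [M] is replaced by its
    Riemann sum; the [1] comes from the separate term [M T]. For [s] in the cell after [t k] it
    telescopes to [expR (r * (T - t k))], which exceeds the exact weight at [s] by a factor of at
    most [expR (r * h)]. *)
Lemma stieltjes_sum_expR_bounds (R : realType) (r T h s : R) (t : nat -> R)
    (n : nat) : 0 <= r -> 0 <= h -> (forall k, t k <= t k.+1 <= t k + h) ->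
  t 0 = 0 -> t n = T -> 0 <= s <= T ->
  expR (r * (T - s)) <=
  1 + \sum_(0 <= k < n)
    (expR (r * (T - t k)) - expR (r * (T - t k.+1))) * (s <= t k.+1)%R%:R
  <= expR (r * h) * expR (r * (T - s)).
Proof.
move=> r0 h0 tS t0 tnT /andP[s0 sT].
pose S k := \sum_(0 <= j < k)
  (expR (r * (T - t j)) - expR (r * (T - t j.+1))) * (s <= t j.+1)%R%:R.
(* Up to [s] the partial sum is zero; after [s] the quantity [expR (r * (T - t k)) + S k] no longer
   changes with [k]. *)
suff H k : (s <= t k -> expR (r * (T - s)) <= expR (r * (T - t k)) + S k
      <= expR (r * h) * expR (r * (T - s))) /\ (t k < s -> S k = 0).
  by have [+ _] := H n; rewrite tnT subrr mulr0 expR0; exact.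
elim: k => [|k [IH1 IH2]].
  rewrite /S big_nil t0; split => // s_le0.
  have -> : s = 0 by apply/le_anti; rewrite s0 s_le0.
  by rewrite addr0 lexx/= ler_peMl ?expR_ge0// -[leLHS]expR0 ler_expR mulr_ge0.
have /andP[tk1 tk2] := tS k.
have SS : S k.+1 = S k + (expR (r * (T - t k)) - expR (r * (T - t k.+1)))
  * (s <= t k.+1)%R%:R by rewrite /S big_nat_recr.
split => [st|ts]; last first.
  by rewrite SS leNgt ts mulr0 addr0 IH2// (le_lt_trans tk1 ts).
have -> : expR (r * (T - t k.+1)) + S k.+1 = expR (r * (T - t k)) + S k.
  by rewrite SS st mulr1; ring.
have [stk|tks] := leP s (t k); first exact: IH1.
rewrite IH2// addr0 -expRD !ler_expR -mulrDr.
by rewrite !ler_wpM2l//; lra.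
Qed.

Section weighted_ito.
Context {R : realType} {d : measure_display} {Omega : measurableType d}.
Variables (P : probability Omega R) (T : R) (F : R -> set (set Omega)).
Variable B : R -> Omega -> R.
Hypothesis hF : filtration T F.
Hypothesis hB : brownian_motion P T F B.
Hypothesis T0 : 0 < T.

(** By [ito_restrict], [M (t k)] integrates [I] cut off after [t k], so a weighted sum of values of
    [M] is the integral of a single deterministic function. Measurability is carried along because
    [ito_lin] asks for it at each step. *)
Lemma ito_sum (I : R -> R) (M : R -> Omega -> R) (c t : nat -> R) (n : nat) :
  measurable_fun `[0, T] I ->
  (forall s, 0 <= s <= T -> is_ito_integral P B I s (M s)) ->
  (forall k, (k < n)%N -> 0 <= t k <= T) ->
  measurable_fun `[0, T]
    (fun s => I s * (1 + \sum_(0 <= k < n) c k * (s <= t k)%R%:R)) /\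
  is_ito_integral P B
    (fun s => I s * (1 + \sum_(0 <= k < n) c k * (s <= t k)%R%:R)) T
    (fun w => M T w + \sum_(0 <= k < n) c k * M (t k) w).
Proof.
move=> mI iM; elim: n => [_|n IH tT].
  rewrite (_ : (fun s => _) = I); last first.
    by apply/funext => s; rewrite big_nil addr0 mulr1.
  split => //; rewrite (_ : (fun w => _) = M T); last first.
    by apply/funext => s; rewrite big_nil addr0.
  by apply: iM; rewrite lexx (ltW T0).
have [|mn itn] := IH; first by move=> k kn; apply: tT; exact: ltnW.
have tnT := tT n (ltnSn n); have /andP[tn0 tnT'] := tnT.
have m1 : measurable_fun `[0, T] (fun s => I s * (s <= t n)%R%:R).
  apply: measurable_funM => //; apply: measurable_funTS.
  rewrite (_ : (fun s => _) = \1_`]-oo, t n]) //.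
  by apply/funext => s; rewrite indicE mem_setE in_itv.
have E : (fun s => I s * (1 + \sum_(0 <= k < n.+1) c k * (s <= t k)%R%:R)) =
  (fun s => 1 * (I s * (1 + \sum_(0 <= k < n) c k * (s <= t k)%R%:R))
            + c n * (I s * (s <= t n)%R%:R)).
  by apply/funext => s; rewrite big_nat_recr//=; ring.
rewrite E; split.
  by apply: measurable_funD; exact: measurable_funM.
rewrite (_ : (fun w => _) = (fun w =>
    1 * (M T w + \sum_(0 <= k < n) c k * M (t k) w) + c n * M (t n) w)); last first.
  by apply/funext => w; rewrite big_nat_recr//= mul1r addrA.
apply: (ito_lin hF hB) => //.
by apply: ito_restrict => //; exact: iM.
Qed.

(** [Y] is what integration by parts makes of the Ito integral of [expR (r * (T - s)) * I s]. Only
    its law is determined: the Riemann sums [Yn] are Ito integrals of [f n] and converge almost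
    surely, while the pointwise bounds [fE] squeeze their variances. *)
Lemma ito_weighted_mgf (I : R -> R) (M : R -> Omega -> R) (r : R)
    (Y : Omega -> R) (a : R) : 0 <= r ->
  measurable_fun `[0, T] I ->
  lebesgue_measure.-integrable `[0, T] (fun x => (I x ^+ 2)%:E) ->
  ito_integral_process P T B I M ->
  measurable_fun setT Y ->
  {ae P, forall w, Y w = M T w +
    \int[lebesgue_measure]_(s in `[0, T]) (r * expR (r * (T - s)) * M s w)} ->
  (\int[P]_w (expR (a * Y w))%:E = (expR (a ^+ 2 / 2 *
     \int[lebesgue_measure]_(s in `[0, T]) ((expR (r * (T - s)) * I s) ^+ 2)%R))%:E)%E.
Proof.
move=> r0 mI iI [cM iM] mY YE; move: a.
pose c n k := expR (r * (T - unif_part T n k)) - expR (r * (T - unif_part T n k.+1)).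
pose f n s := I s * (1 + \sum_(0 <= k < n.+1) c n k * (s <= unif_part T n k.+1)%R%:R).
pose Yn n w := M T w + \sum_(0 <= k < n.+1) c n k * M (unif_part T n k.+1) w.
have tT n k : (k < n.+1)%N -> 0 <= unif_part T n k.+1 <= T.
  by move=> kn; exact: unif_part_in.
have mf n : measurable_fun `[0, T] (f n).
  by have [] := ito_sum (c n) mI iM (tT n).
have itf n : is_ito_integral P B (f n) T (Yn n).
  by have [] := ito_sum (c n) mI iM (tT n).
have fE n s : 0 <= s <= T ->
    (expR (r * (T - s)) * I s) ^+ 2 <= f n s ^+ 2 <=
    expR (r * (T / n.+1%:R)) ^+ 2 * (expR (r * (T - s)) * I s) ^+ 2.
  move=> s0T.
  have h0 : 0 <= T / n.+1%:R by rewrite divr_ge0// ltW.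
  have /andP[b1 b2] := stieltjes_sum_expR_bounds r0 h0
    (unif_part_step T0 n) (unif_part0 T n) (unif_part_end T n) s0T.
  have S0 := le_trans (expR_ge0 _) b1.
  have I2 := sqr_ge0 (I s).
  have W0 := expR_ge0 (r * (T - s)); have H0 := expR_ge0 (r * (T / n.+1%:R)).
  rewrite /f; move: (1 + _) b1 b2 S0 => S b1 b2 S0.
  have -> : (I s * S) ^+ 2 = I s ^+ 2 * S ^+ 2 by ring.
  have -> : expR (r * (T / n.+1%:R)) ^+ 2 * (expR (r * (T - s)) * I s) ^+ 2
    = I s ^+ 2 * (expR (r * (T / n.+1%:R)) * expR (r * (T - s))) ^+ 2 by ring.
  have -> : (expR (r * (T - s)) * I s) ^+ 2 = I s ^+ 2 * expR (r * (T - s)) ^+ 2.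
    by ring.
  by rewrite !ler_wpM2l// lerXn2r ?nnegrE// mulr_ge0.
have mW : measurable_fun `[0, T] (fun s => expR (r * (T - s)) * I s).
  apply: measurable_funM => //; apply: measurable_funTS.
  by apply: continuous_measurable_fun; exact: continuous_expR_rev.
have iW : lebesgue_measure.-integrable `[0, T]
    (fun s => ((expR (r * (T - s)) * I s) ^+ 2)%:E).
  apply: (@itvcc_le_integrable _ _ _ _ (fun s => expR (r * T) ^+ 2 * I s ^+ 2)).
  - exact: measurable_funX.
  - move=> s /andP[s0 sT]; rewrite ger0_norm ?sqr_ge0// exprMn ler_wpM2r ?sqr_ge0//.
    rewrite lerXn2r ?nnegrE ?expR_ge0// ler_expR ler_wpM2l// lerBlDr.
    by rewrite lerDl.
  - exact: EFin_integrableZl.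
have if_ n : lebesgue_measure.-integrable `[0, T] (fun s => (f n s ^+ 2)%:E).
  apply: (@itvcc_le_integrable _ _ _ _ (fun s =>
    expR (r * (T / n.+1%:R)) ^+ 2 * (expR (r * (T - s)) * I s) ^+ 2)).
  - exact: measurable_funX.
  - move=> s s0T; rewrite ger0_norm ?sqr_ge0//.
    by have /andP[] := fE n s s0T.
  - exact: EFin_integrableZl.
pose A := \int[lebesgue_measure]_(s in `[0, T]) ((expR (r * (T - s)) * I s) ^+ 2).
apply: (@mgf_lim _ _ _ P Yn Y
  (fun n => \int[lebesgue_measure]_(x in `[0, T]) (f n x ^+ 2))) => //.
- by move=> n; have [] := itf n.
- by move=> n a; exact: (ito_mgf hF hB _ (ltW T0)).
- apply: (@squeeze_cvgr _ _ _ _ (cst A)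
    (fun n => expR (r * T * n.+1%:R^-1) ^+ 2 * A)).
  + apply: nearW => n; apply/andP; split.
      apply: (le_Rintegral _ iW (if_ n)) => // s /=; rewrite in_itv/= => s0T.
      by have /andP[] := fE n s s0T.
    rewrite /A -RintegralZl//; apply: (le_Rintegral _ (if_ n)) => //.
      exact: EFin_integrableZl.
    move=> s /=; rewrite in_itv/= => s0T; rewrite -mulrA.
    by have /andP[] := fE n s s0T.
  + exact: cvg_cst.
  + have -> : \int[lebesgue_measure]_(s in `[0, T]) ((expR (r * (T - s)) * I s) ^+ 2)
      = expR (r * T * 0) ^+ 2 * A by rewrite mulr0 expR0 expr1n mul1r.
    have h : expR (r * T * n.+1%:R^-1) @[n --> \oo] --> expR (r * T * 0).
      apply: (@continuous_cvg _ _ _ _ _ _ expR); first exact: continuous_expR.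
      by apply: cvgMl_tmp; exact: cvg_harmonic.
    by apply: cvgMr_tmp; exact: (cvgM h h).
- move=> a k; apply: cvg_truncated_mgf_ae => //.
    by move=> n; have [] := itf n.
  move: YE; apply: filterS2 cM => w cMw ->.
  apply: cvgD; first exact: cvg_cst.
  exact: cvg_stieltjes_sum_expR.
Qed.

End weighted_ito.

(** * The wealth equation *)

Lemma patch_integrable (R : realType) (a b : R) (g : R -> R) :
  lebesgue_measure.-integrable `[a, b] (fun u => (g u)%:E) ->
  lebesgue_measure.-integrable setT (fun u => ((g \_ `[a, b]) u)%:E).
Proof.
move=> gi.
rewrite (_ : (fun s => _) = (EFin \o g) \_ `[a, b]); last first.
  by apply/funext => x; rewrite restrict_EFin.
apply: (proj1 (integrable_mkcond _ _)); last exact: gi.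
exact: measurable_itv.
Qed.

(** Both sides integrate [g s * k u] over the triangle [0 <= u <= s <= t]. Extending [g] and [k] by
    zero turns this into Fubini on the plane, with the triangle encoded by the factor [u <= s]. *)
Lemma Fubini_triangle (R : realType) (t : R) (g k : R -> R) :
  {within `[0, t], continuous g} ->
  lebesgue_measure.-integrable `[0, t] (fun u => (k u)%:E) ->
  \int[lebesgue_measure]_(s in `[0, t])
    (g s * \int[lebesgue_measure]_(u in `[0, s]) k u) =
  \int[lebesgue_measure]_(u in `[0, t])
    (k u * \int[lebesgue_measure]_(s in `[u, t]) g s).
Proof.
move=> cg ki; have gi := continuous_itvcc_integrable cg.
pose mu : {sigma_finite_measure set (measurableTypeR R) -> \bar R} :=
  lebesgue_measure.
pose gt := g \_ `[0, t]; pose kt := k \_ `[0, t].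
have gti : mu.-integrable setT (fun s => (gt s)%:E) by exact: patch_integrable.
have kti : mu.-integrable setT (fun s => (kt s)%:E) by exact: patch_integrable.
have mgt : measurable_fun setT gt by apply/measurable_EFinP; exact: measurable_int gti.
have mkt : measurable_fun setT kt by apply/measurable_EFinP; exact: measurable_int kti.
pose f (z : measurableTypeR R * measurableTypeR R) : \bar R :=
  (gt z.1 * kt z.2 * (z.2 <= z.1)%R%:R)%:E.
have mf : measurable_fun setT f.
  apply/measurable_EFinP; apply: measurable_funM.
    by apply: measurable_funM; exact: measurableT_comp.
  rewrite (_ : (fun z => _) =
     \1_[set z : measurableTypeR R * measurableTypeR R | z.2 <= z.1]).
    apply: measurable_indic.
    by rewrite -[X in measurable X]setTI; apply: measurable_fun_le.
  apply/funext => z; rewrite indicE; congr (nat_of_bool _)%:R.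
  by apply/idP/idP; rewrite inE.
have maf : measurable_fun setT (fun z => `|f z|%E) by exact: measurableT_comp.
have fi : (mu \x mu)%E.-integrable setT f.
  apply/(integrable12ltyP mu mu mf).
  pose K := (\int[mu]_u `|(kt u)%:E|)%E.
  apply: (@le_lt_trans _ _ (\int[mu]_s (`|(gt s)%:E| * K))%E).
    apply: ge0_le_integral => //.
    - by move=> s _; apply: integral_ge0.
    - by apply: (measurable_fun_fubini_tonelli_F (m2 := mu) (fun z => `|f z|%E)).
    - apply: emeasurable_funM => //; apply: measurableT_comp => //.
      exact/measurable_EFinP.
    - move=> s _; rewrite /K -ge0_integralZl//; last first.
        by apply: measurableT_comp => //; exact/measurable_EFinP.
      apply: ge0_le_integral => //.
      + apply: measurableT_comp => //; apply/measurable_EFinP.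
        rewrite /=; apply: measurable_funM; first exact: measurable_funM.
        rewrite (_ : (fun u => _) = \1_`]-oo, s]) //.
        by apply/funext => z; rewrite indicE mem_setE in_itv.
      + by apply: measurable_funeM; apply: measurableT_comp => //; exact/measurable_EFinP.
      + move=> u _; rewrite /f/= -EFinM lee_fin 2!normrM ler_piMr ?mulr_ge0//.
        by case: (u <= s)%R; rewrite ?normr1 ?normr0.
  rewrite ge0_integralZr//; last 2 first.
  - by apply: measurableT_comp => //; exact/measurable_EFinP.
  - exact: integral_ge0.
  have /integrableP[_ k1] := kti; have /integrableP[_ g1] := gti.
  have K0 : (0 <= K)%E by exact: integral_ge0.
  have G0 : (0 <= \int[mu]_s `|(gt s)%:E|)%E by exact: integral_ge0.
  by apply: lte_mul_pinfty => //; rewrite ge0_fin_numE.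
have := Fubini fi.
have -> : (\int[mu]_s \int[mu]_u f (s, u) = \int[mu]_(s in `[0%R, t])
    (g s * \int[lebesgue_measure]_(u in `[0, s]) k u)%:E)%E.
  rewrite [RHS]integral_mkcond; apply: eq_integral => s _.
  rewrite patchE mem_setE in_itv/=; case: ifPn => [/andP[s0 st]|sN]; last first.
    by rewrite /f /= /gt patchE mem_setE in_itv/= (negbTE sN);
      under eq_integral do rewrite mul0r mul0r; rewrite integral0.
  have ks : lebesgue_measure.-integrable `[0, s] (fun u => (k u)%:E).
    by apply: integrableS ki => //; apply: subset_itvl; rewrite bnd_simp.
  transitivity (\int[mu]_u ((g s)%:E * ((k \_ `[0%R, s]) u)%:E))%E.
    apply: eq_integral => u _; rewrite -EFinM /f/= /gt /kt !patchE.
    rewrite !mem_setE !in_itv/= s0 st -mulrA; congr (_ * _)%:E.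
    have [u0|u0] := leP 0 u => /=; last by rewrite mul0r.
    have [us|su] := leP u s; first by rewrite (le_trans us st) mulr1.
    by rewrite mulr0.
  rewrite integralZl//; last exact: patch_integrable.
  by rewrite EFinM Rintegral_mkcond fineK//; apply: integrable_fin_num => //;
    exact: patch_integrable.
have -> : (\int[mu]_u \int[mu]_s f (s, u) = \int[mu]_(u in `[0%R, t])
    (k u * \int[lebesgue_measure]_(s in `[u, t]) g s)%:E)%E.
  rewrite [RHS]integral_mkcond; apply: eq_integral => u _.
  rewrite patchE mem_setE in_itv/=; case: ifPn => [/andP[u0 ut]|uN]; last first.
    by rewrite /f /= /kt patchE mem_setE in_itv/= (negbTE uN);
      under eq_integral do rewrite mulr0 mul0r; rewrite integral0.
  have gs : lebesgue_measure.-integrable `[u, t] (fun u => (g u)%:E).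
    by apply: integrableS gi => //; apply: subset_itvr; rewrite bnd_simp.
  transitivity (\int[mu]_s ((k u)%:E * ((g \_ `[u, t]) s)%:E))%E.
    apply: eq_integral => s _; rewrite -EFinM /f/= /gt /kt !patchE.
    rewrite !mem_setE !in_itv/= u0 ut mulrAC mulrC; congr (_ * _)%:E.
    have [us|su] := leP u s => /=; last by rewrite mulr0.
    by rewrite (le_trans u0 us)/= mulr1.
  rewrite integralZl//; last exact: patch_integrable.
  by rewrite EFinM Rintegral_mkcond fineK//; apply: integrable_fin_num => //;
    exact: patch_integrable.
by rewrite /Rintegral => ->.
Qed.

(** Integration by parts against the primitive of [k]. As [k] is only integrable, the primitive is
    not differentiated; the order of integration is exchanged instead. *)
Lemma Rintegral_expR_primitive (R : realType) (c t : R) (k : R -> R) :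
  lebesgue_measure.-integrable `[0, t] (fun u => (k u)%:E) ->
  \int[lebesgue_measure]_(s in `[0, t])
    (c * expR (c * s) * \int[lebesgue_measure]_(u in `[0, s]) k u) =
  \int[lebesgue_measure]_(u in `[0, t]) (k u * (expR (c * t) - expR (c * u))).
Proof.
move=> ki; rewrite Fubini_triangle//; last first.
  by apply: continuous_subspaceT => x; apply: cvgMl_tmp; exact: continuous_expR_lin.
apply: eq_Rintegral => u; rewrite inE/= in_itv/= => /andP[_ ut].
by rewrite Rintegral_expR.
Qed.

Lemma itvcc_integrableMl (R : realType) (a b K : R) (phi g : R -> R) :
  measurable_fun `[a, b] phi -> (forall s, a <= s <= b -> `|phi s| <= K) ->
  lebesgue_measure.-integrable `[a, b] (fun s => (g s)%:E) ->
  lebesgue_measure.-integrable `[a, b] (fun s => (phi s * g s)%:E).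
Proof.
move=> mphi phiK gi.
have mg : measurable_fun `[a, b] g.
  by apply/measurable_EFinP; exact: measurable_int gi.
apply: (@itvcc_le_integrable _ _ _ _ (fun s => K * `|g s|)).
- exact: measurable_funM.
- by move=> s sab; rewrite normrM ler_wpM2r// phiK.
- by apply: EFin_integrableZl => //; exact: integrable_abse gi.
Qed.

Lemma itvcc_integrableMr (R : realType) (a b K : R) (g phi : R -> R) :
  measurable_fun `[a, b] phi -> (forall s, a <= s <= b -> `|phi s| <= K) ->
  lebesgue_measure.-integrable `[a, b] (fun s => (g s)%:E) ->
  lebesgue_measure.-integrable `[a, b] (fun s => (g s * phi s)%:E).
Proof.
move=> mphi phiK gi; rewrite (_ : (fun s => _) = (fun s => (phi s * g s)%:E)).
  exact: itvcc_integrableMl phiK gi.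
by apply/funext => s; rewrite mulrC.
Qed.

Lemma measurable_expR_rev (R : realType) (D : set R) (c T : R) :
  measurable_fun D (fun s => expR (c * (T - s))).
Proof.
apply: measurable_funTS; apply: continuous_measurable_fun.
exact: continuous_expR_rev.
Qed.

Lemma expR_rev_le (R : realType) (c T s : R) : 0 <= c -> 0 <= s ->
  `|expR (c * (T - s))| <= expR (c * T).
Proof.
by move=> c0 s0; rewrite ger0_norm ?expR_ge0// ler_expR ler_wpM2l// gerBl.
Qed.

Lemma expR_rev_integrableMl (R : realType) (c T : R) (g : R -> R) : 0 <= c ->
  lebesgue_measure.-integrable `[0, T] (fun s => (g s)%:E) ->
  lebesgue_measure.-integrable `[0, T] (fun s => (expR (c * (T - s)) * g s)%:E).
Proof.
move=> c0; apply: (@itvcc_integrableMl _ _ _ (expR (c * T))).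
  exact: measurable_expR_rev.
by move=> s /andP[s0 _]; exact: expR_rev_le.
Qed.

Lemma sqr_integrable_itvcc (R : realType) (a b : R) (f : R -> R) :
  measurable_fun `[a, b] f ->
  lebesgue_measure.-integrable `[a, b] (fun s => (f s ^+ 2)%:E) ->
  lebesgue_measure.-integrable `[a, b] (fun s => (f s)%:E).
Proof.
move=> mf f2; apply: (@itvcc_le_integrable _ _ _ _ (fun s => 1 + f s ^+ 2)) => //.
- move=> s _; rewrite ler_norml.
  have := sqr_ge0 (f s - 1); have := sqr_ge0 (f s + 1); nra.
- apply: EFin_integrableD => //.
  by apply: (@itvcc_bounded_integrable _ _ _ _ 1) => // s _; rewrite normr1.
Qed.

(** Variation of constants with a driver [M] that is merely continuous. The primitive of [r * X + g]
    is [X - x - sigma * M]; integrating it against [- r * expR (- r * s)] and exchanging integrals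
    makes the unknown weighted integral of [X] appear on both sides and cancel. *)
Lemma linear_integral_equation (R : realType) (r T x sigma : R)
    (X M g : R -> R) : 0 <= r -> 0 <= T ->
  {within `[0, T], continuous X} -> {within `[0, T], continuous M} ->
  lebesgue_measure.-integrable `[0, T] (fun s => (g s)%:E) ->
  (forall t, 0 <= t <= T -> X t = x
    + \int[lebesgue_measure]_(s in `[0, t]) (r * X s + g s) + sigma * M t) ->
  X T = expR (r * T) * x
    + \int[lebesgue_measure]_(s in `[0, T]) (expR (r * (T - s)) * g s)
    + sigma * (M T + \int[lebesgue_measure]_(s in `[0, T])
                       (r * expR (r * (T - s)) * M s)).
Proof.
move=> r0 T0 cX cM gi XE.
pose mu := @lebesgue_measure R.
have Xi := continuous_itvcc_integrable cX.
have Mi := continuous_itvcc_integrable cM.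
have hi : lebesgue_measure.-integrable `[0, T] (fun s => (r * X s + g s)%:E).
  by apply: EFin_integrableD => //; exact: EFin_integrableZl.
pose e s := expR (r * (T - s)).
have eXi := expR_rev_integrableMl r0 Xi.
have eMi := expR_rev_integrableMl r0 Mi.
have egi := expR_rev_integrableMl r0 gi.
have ei := expR_rev_integrable r T 0 T.
have ehi := expR_rev_integrableMl r0 hi.
have := Rintegral_expR_primitive (- r) hi.
have -> : \int[lebesgue_measure]_(s in `[0, T]) (- r * expR (- r * s) *
      \int[lebesgue_measure]_(u in `[0, s]) (r * X u + g u))
    = - expR (- r * T) * (r * (\int[lebesgue_measure]_(s in `[0, T]) (e s * X s)
        - x * \int[lebesgue_measure]_(s in `[0, T]) e s
        - sigma * \int[lebesgue_measure]_(s in `[0, T]) (e s * M s))).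
  transitivity (\int[lebesgue_measure]_(s in `[0, T]) (- expR (- r * T) *
      (r * (e s * X s - x * e s - sigma * (e s * M s))))).
    apply: eq_Rintegral => s; rewrite inE/= in_itv/= => sT.
    have -> : \int[lebesgue_measure]_(u in `[0, s]) (r * X u + g u)
      = X s - x - sigma * M s by rewrite (XE s sT); ring.
    have -> : expR (- r * s) = expR (- r * T) * e s.
      by rewrite /e -expRD; congr expR; ring.
    by ring.
  have i1 : lebesgue_measure.-integrable `[0, T] (fun s => (x * e s)%:E).
    exact: EFin_integrableZl.
  have i2 : lebesgue_measure.-integrable `[0, T] (fun s => (sigma * (e s * M s))%:E).
    exact: EFin_integrableZl.
  have i3 : lebesgue_measure.-integrable `[0, T] (fun s => (e s * X s - x * e s)%:E).
    exact: EFin_integrableB.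
  have i4 : lebesgue_measure.-integrable `[0, T]
      (fun s => (e s * X s - x * e s - sigma * (e s * M s))%:E).
    exact: EFin_integrableB.
  rewrite RintegralZl//; last exact: EFin_integrableZl.
  by rewrite RintegralZl// RintegralB// RintegralB// RintegralZl// RintegralZl.
have -> : \int[lebesgue_measure]_(u in `[0, T])
      ((r * X u + g u) * (expR (- r * T) - expR (- r * u)))
    = expR (- r * T) * (\int[lebesgue_measure]_(s in `[0, T]) (r * X s + g s)
      - (r * \int[lebesgue_measure]_(s in `[0, T]) (e s * X s)
        + \int[lebesgue_measure]_(s in `[0, T]) (e s * g s))).
  transitivity (\int[lebesgue_measure]_(s in `[0, T]) (expR (- r * T) *
      (r * X s + g s - (r * (e s * X s) + e s * g s)))).
    apply: eq_Rintegral => s _.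
    have -> : expR (- r * s) = expR (- r * T) * e s.
      by rewrite /e -expRD; congr expR; ring.
    by ring.
  have i1 : lebesgue_measure.-integrable `[0, T] (fun s => (r * (e s * X s))%:E).
    exact: EFin_integrableZl.
  have i2 : lebesgue_measure.-integrable `[0, T]
      (fun s => (r * (e s * X s) + e s * g s)%:E).
    exact: EFin_integrableD.
  rewrite RintegralZl//; last exact: EFin_integrableB.
  by rewrite RintegralB// [X in _ * (_ - X)]RintegralD// RintegralZl.
move=> /eqP; rewrite mulNr -mulrN; move/eqP/mulfI; rewrite gt_eqF ?expR_gt0//.
move=> /(_ isT).
have := @Rintegral_expR_rev _ r T 0 T T0.
rewrite subrr subr0 mulr0 expR0 RintegralZl// -/(e _).
have -> : \int[lebesgue_measure]_(s in `[0, T]) (r * expR (r * (T - s)) * M s)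
    = r * \int[lebesgue_measure]_(s in `[0, T]) (e s * M s).
  by rewrite -RintegralZl//; apply: eq_Rintegral => s _; rewrite mulrA.
have := XE T; rewrite lexx T0 => /(_ isT).
rewrite /e.
set Ie := \int[lebesgue_measure]_(s in `[0, T]) expR (r * (T - s)).
set IX := \int[lebesgue_measure]_(s in `[0, T]) (expR (r * (T - s)) * X s).
set IM := \int[lebesgue_measure]_(s in `[0, T]) (expR (r * (T - s)) * M s).
set Ig := \int[lebesgue_measure]_(s in `[0, T]) (expR (r * (T - s)) * g s).
set Ih := \int[lebesgue_measure]_(s in `[0, T]) (r * X s + g s).
move=> XT He H.
have -> : expR (r * T) * x = x + r * x * Ie by rewrite mulrAC He; ring.
by rewrite XT; lra.
Qed.

(** Duhamel's solution of [D' = r D + h] with [D 0 = 0], in integral form since [h] is only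
    integrable. *)
Lemma discounted_integral_equation (R : realType) (r t : R) (h : R -> R) :
  0 <= t -> lebesgue_measure.-integrable `[0, t] (fun s => (h s)%:E) ->
  let D u := expR (r * u) *
    \int[lebesgue_measure]_(s in `[0, u]) (expR (- r * s) * h s) in
  {within `[0, t], continuous D} /\
  D t = \int[lebesgue_measure]_(s in `[0, t]) (r * D s + h s).
Proof.
move=> t0 hi D.
have ki : lebesgue_measure.-integrable `[0, t] (fun s => (expR (- r * s) * h s)%:E).
  apply: (@itvcc_integrableMl _ _ _ (expR (`|r| * t))) => //.
    apply: measurable_funTS; apply: continuous_measurable_fun.
    exact: continuous_expR_lin.
  move=> s /andP[s0 st]; rewrite ger0_norm ?expR_ge0// ler_expR.
  by rewrite (le_trans (ler_norm _))// normrM normrN (ger0_norm s0) ler_wpM2l.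
have cD : {within `[0, t], continuous D}.
  move=> x; apply: cvgM.
    by have := @continuous_subspaceT _ _ `[0, t] _ (@continuous_expR_lin R r); apply.
  by have := parameterized_integral_continuous t0 ki; apply.
split => //.
have Di := continuous_itvcc_integrable cD.
rewrite RintegralD//; last exact: EFin_integrableZl.
have := Rintegral_expR_primitive r ki.
have -> : \int[lebesgue_measure]_(s in `[0, t]) (r * expR (r * s) *
      \int[lebesgue_measure]_(u in `[0, s]) (expR (- r * u) * h u))
    = \int[lebesgue_measure]_(s in `[0, t]) (r * D s).
  by apply: eq_Rintegral => s _; rewrite /D mulrA.
move=> ->.
have -> : \int[lebesgue_measure]_(u in `[0, t])
      (expR (- r * u) * h u * (expR (r * t) - expR (r * u)))
    = \int[lebesgue_measure]_(u in `[0, t])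
      (expR (r * t) * (expR (- r * u) * h u) - h u).
  apply: eq_Rintegral => u _.
  have E : expR (- r * u) * expR (r * u) = 1.
    by rewrite -expRD mulNr addNr expR0.
  by rewrite mulrBr mulrC; congr (_ - _); rewrite mulrAC E mul1r.
rewrite RintegralB//; last exact: EFin_integrableZl.
by rewrite subrK RintegralZl.
Qed.

(** * The fund process: terminal law and competitors *)

Section fund.
Context {R : realType} {d : measure_display} {Omega : measurableType d}.
Variables (P : probability Omega R) (F : R -> set (set Omega)).
Variables (B : R -> Omega -> R) (r T sigma v x1 : R).
Hypothesis hF : filtration T F.
Hypothesis hB : brownian_motion P T F B.
Hypothesis r0 : 0 < r.
Hypothesis T0 : 0 < T.

(** Mean of the Gaussian terminal wealth minus [alpha / 2] times its variance. *)
Definition certainty_equivalent (alpha : R) (I C : R -> R) : R :=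
  expR (r * T) * x1
  + \int[lebesgue_measure]_(s in `[0, T]) (expR (r * (T - s)) * (v * I s - C s))
  - alpha * sigma ^+ 2 / 2 *
    \int[lebesgue_measure]_(s in `[0, T]) ((expR (r * (T - s)) * I s) ^+ 2).

Lemma fund_drift_integrable (t : R) (I C X : R -> R) : t <= T ->
  admissible T I C -> {within `[0, T], continuous X} ->
  lebesgue_measure.-integrable `[0, t] (fun s => (r * X s + v * I s - C s)%:E).
Proof.
move=> tT [mI [I2 [Ci _]]] cX.
suff : lebesgue_measure.-integrable `[0, T] (fun s => (r * X s + v * I s - C s)%:E).
  by apply: integrableS => //; apply: subset_itvl; rewrite bnd_simp.
apply: EFin_integrableB => //; apply: EFin_integrableD => //.
  by apply: EFin_integrableZl => //; exact: continuous_itvcc_integrable.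
by apply: EFin_integrableZl => //; exact: sqr_integrable_itvcc.
Qed.

Lemma fund_terminal_mgf (alpha : R) (I C : R -> R) (X : R -> Omega -> R) :
  0 < sigma -> admissible T I C -> fund_process P F B r T sigma v x1 I C X ->
  (\int[P]_w (expR (- (alpha * X T w)))%:E
   = (expR (- (alpha * certainty_equivalent alpha I C)))%:E)%E.
Proof.
move=> s0 [mI [I2 [Ci Cpos]]] [aX [cX [M [[cM iM] XE]]]].
pose g s := v * I s - C s.
have gi : lebesgue_measure.-integrable `[0, T] (fun s => (g s)%:E).
  apply: EFin_integrableB => //; apply: EFin_integrableZl => //.
  exact: sqr_integrable_itvcc.
pose D := expR (r * T) * x1
  + \int[lebesgue_measure]_(s in `[0, T]) (expR (r * (T - s)) * g s).
(* Defining the noise from [X T] makes it measurable by adaptedness; its expression through [M] is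
   then needed only almost everywhere. *)
pose Y w := (X T w - D) / sigma.
have mX : measurable_fun setT (X T).
  by apply: (adapted_measurable hF aX); rewrite lexx (ltW T0).
have mY : measurable_fun setT Y.
  by apply: measurable_funM => //; exact: measurable_funB.
have YE : {ae P, forall w, Y w = M T w +
    \int[lebesgue_measure]_(s in `[0, T]) (r * expR (r * (T - s)) * M s w)}.
  apply: filterS3 cX cM XE => w cXw cMw XEw.
  have := @linear_integral_equation _ r T x1 sigma (X ^~ w) (M ^~ w) g
    (ltW r0) (ltW T0) cXw cMw gi.
  move=> H; rewrite /Y H.
    by rewrite -/D addrC addKr mulrC mulKf// gt_eqF.
  move=> t tT; rewrite (XEw t tT); congr (_ + _ + _).
  by apply: eq_Rintegral => s _; rewrite addrA.
have XY w : - (alpha * X T w) = - (alpha * D) + (- (alpha * sigma)) * Y w.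
  by rewrite /Y; field; rewrite gt_eqF.
under eq_integral do rewrite XY expRD EFinM.
rewrite ge0_integralZl//; last first.
  apply/measurable_EFinP; apply: measurableT_comp => //.
  exact: measurable_funM.
rewrite (ito_weighted_mgf hF hB T0 _ (ltW r0) mI I2 (conj cM iM) mY YE).
rewrite -EFinM -expRD; congr (expR _)%:E.
by rewrite /certainty_equivalent -/(g _) -/D; field.
Qed.

(* The deterministic correction [D] compensates the change of consumption. *)
Lemma fund_process_comb (I1 I2 C1 C2 C : R -> R) (X1 X2 : R -> Omega -> R) (e : R) :
  admissible T I1 C1 -> admissible T I2 C2 ->
  lebesgue_measure.-integrable `[0, T] (fun s => (C s)%:E) ->
  fund_process P F B r T sigma v x1 I1 C1 X1 ->
  fund_process P F B r T sigma v x1 I2 C2 X2 ->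
  exists X, fund_process P F B r T sigma v x1
    (fun t => (1 - e) * I1 t + e * I2 t) C X.
Proof.
move=> adm1 adm2 Ci [aX1 [cX1 [M1 [[cM1 iM1] XE1]]]] [aX2 [cX2 [M2 [[cM2 iM2] XE2]]]].
have [mI1 [I1i [C1i _]]] := adm1; have [mI2 [I2i [C2i _]]] := adm2.
pose h s := (1 - e) * C1 s + e * C2 s - C s.
pose D u := expR (r * u) *
    \int[lebesgue_measure]_(s in `[0, u]) (expR (- r * s) * h s).
have hi : lebesgue_measure.-integrable `[0, T] (fun s => (h s)%:E).
  apply: EFin_integrableB => //; apply: EFin_integrableD => //.
    exact: EFin_integrableZl.
  exact: EFin_integrableZl.
have [cD _] := discounted_integral_equation r (ltW T0) hi.
pose X t w := (1 - e) * X1 t w + e * X2 t w + D t.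
pose M t w := (1 - e) * M1 t w + e * M2 t w.
exists X; split; [|split].
- move=> t tT; have [Fs _] := hF.
  apply/(measurable_fun_sigmaP _ (Fs t tT)).
  have m1 := (measurable_fun_sigmaP _ (Fs t tT)).1 (aX1 t tT).
  have m2 := (measurable_fun_sigmaP _ (Fs t tT)).1 (aX2 t tT).
  apply: measurable_funD => //.
  by apply: measurable_funD; exact: measurable_funM.
- apply: filterS2 cX1 cX2 => w c1 c2 x.
  apply: cvgD; last exact: cD.
  by apply: cvgD; apply: cvgMl_tmp; [exact: c1|exact: c2].
- exists M; split; first split.
  + apply: filterS2 cM1 cM2 => w c1 c2 x.
    by apply: cvgD; apply: cvgMl_tmp; [exact: c1|exact: c2].
  + move=> t /[dup] t0T /andP[t0 tT].
    have sub : `[0, t] `<=` `[0, T] by apply: subset_itvl; rewrite bnd_simp.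
    apply: (ito_lin hF hB) => //.
    * exact: measurable_funS mI1.
    * exact: measurable_funS mI2.
    * exact: iM1.
    * exact: iM2.
  + have cX12 : {ae P, forall w, {within `[0, T], continuous (fun t => X1 t w)} /\
        {within `[0, T], continuous (fun t => X2 t w)}}.
      by apply: filterS2 cX1 cX2.
    apply: filterS3 cX12 XE1 XE2 => w [c1 c2] E1 E2 t /[dup] t0T /andP[t0 tT].
    have hit : lebesgue_measure.-integrable `[0, t] (fun s => (h s)%:E).
      by apply: integrableS hi => //; apply: subset_itvl; rewrite bnd_simp.
    have [cDt DE] := discounted_integral_equation r t0 hit.
    have d1 := fund_drift_integrable tT adm1 c1.
    have d2 := fund_drift_integrable tT adm2 c2.
    have Di := continuous_itvcc_integrable cDt.
    have dD : lebesgue_measure.-integrable `[0, t] (fun s => (r * D s + h s)%:E).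
      by apply: EFin_integrableD => //; exact: EFin_integrableZl.
    have e1 : lebesgue_measure.-integrable `[0, t] (fun s =>
      ((1 - e) * (r * X1 s w + v * I1 s - C1 s))%:E) by exact: EFin_integrableZl.
    have e2 : lebesgue_measure.-integrable `[0, t] (fun s =>
      (e * (r * X2 s w + v * I2 s - C2 s))%:E) by exact: EFin_integrableZl.
    have -> : \int[lebesgue_measure]_(s in `[0, t])
        (r * X s w + v * ((1 - e) * I1 s + e * I2 s) - C s)
      = (1 - e) * \int[lebesgue_measure]_(s in `[0, t])
          (r * X1 s w + v * I1 s - C1 s)
        + e * \int[lebesgue_measure]_(s in `[0, t])
          (r * X2 s w + v * I2 s - C2 s) + D t.
      have -> : D t = \int[lebesgue_measure]_(s in `[0, t]) (r * D s + h s).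
        exact: DE.
      rewrite -RintegralZl// -RintegralZl// -RintegralD// -RintegralD//; last first.
        exact: EFin_integrableD.
      by apply: eq_Rintegral => s _; rewrite /X /h; ring.
    by rewrite /X /M (E1 t t0T) (E2 t t0T); ring.
Qed.

End fund.

(** * First order conditions *)

(** From [expR x <= 1 / (1 - x)]. The bound holds for all negative [x] too, so exponents have to be
    controlled from above only. *)
Lemma expR_le_quadratic (R : realType) (x : R) : x <= 1 / 2 ->
  expR x <= 1 + x + 2 * x ^+ 2.
Proof.
move=> x2; have e0 := expR_gt0 x.
have h : expR x * (1 - x) <= 1.
  have := expR_ge1Dx (- x); rewrite -(ler_pM2l e0) -expRD subrr expR0.
  by [].
have x1 : 0 < 1 - x by lra.
rewrite -(ler_pM2r x1) (le_trans h)//.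
have -> : (1 + x + 2 * x ^+ 2) * (1 - x) = 1 + x ^+ 2 * (1 - 2 * x) by ring.
by rewrite lerDl mulr_ge0 ?sqr_ge0//; lra.
Qed.

(** The direction of perturbation is the defect [g = q - kappa * a] itself, times a weight [c] that
    is positive where [C] is. At step size [e] the first-order part of the assumed inequality is
    then [- e] times the integral of [g^2 c], so this integral is at most zero and [g] vanishes
    almost everywhere. *)
Lemma consumption_first_order (R : realType) (T alpha beta kappa A Q : R)
    (a q C : R -> R) : 0 < alpha -> 0 < beta -> 0 < kappa ->
  measurable_fun `[0, T] a -> (forall s, 0 <= s <= T -> 0 <= a s <= A) ->
  lebesgue_measure.-integrable `[0, T] (fun s => (q s)%:E) ->
  (forall s, 0 <= q s) -> (forall s, 0 <= s <= T -> 0 < C s -> q s <= Q) ->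
  measurable_fun `[0, T] C ->
  {ae lebesgue_measure, forall s, s \in `[0, T] -> 0 < C s} ->
  (forall (h : R -> R) (G : R), measurable_fun `[0, T] h ->
    (forall s, 0 <= s <= T -> `|h s| <= G) ->
    (forall s, 0 <= s <= T -> 0 < C s -> 0 < C s + h s) ->
    0 <= alpha^-1 * kappa * (expR (alpha *
           \int[lebesgue_measure]_(s in `[0, T]) (a s * h s)) - 1)
         + beta^-1 * \int[lebesgue_measure]_(s in `[0, T])
             (q s * expR (- (beta * h s)) - q s)) ->
  {ae lebesgue_measure, forall s, s \in `[0, T] -> q s = kappa * a s}.
Proof.
move=> al0 be0 ka0 ma aA qi q0 qQ mC Cpos opt.
have mq : measurable_fun `[0, T] q by apply/measurable_EFinP; exact: measurable_int qi.
(* The perturbation [h] is dominated by [C], so that [C + e h] stays positive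
   for small [e]. *)
pose c s := Num.max 0 (Num.min (C s) 1).
pose g s := q s - kappa * a s.
pose h s := g s * c s.
have c01 s : 0 <= c s <= 1.
  by rewrite /c le_max lexx/= ge_max ler01/= ge_min lexx orbT.
have mc : measurable_fun `[0, T] c.
  by apply: measurable_maxr => //; exact: measurable_minr.
have mg : measurable_fun `[0, T] g by apply: measurable_funB => //; exact: measurable_funM.
have mh : measurable_fun `[0, T] h by exact: measurable_funM.
pose G := `|Q| + kappa * `|A| + 1.
have G0 : 0 < G by rewrite ltr_wpDl ?addr_ge0 ?mulr_ge0// ltW.
have gG s : 0 <= s <= T -> 0 < C s -> `|g s| <= G.
  move=> sT Cs; have /andP[a1 a2] := aA s sT.
  have q1 := q0 s; have q2 := qQ s sT Cs.
  have A1 := ler_norm A; have Q1 := ler_norm Q.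
  have k1 : 0 <= kappa * a s by rewrite mulr_ge0// ltW.
  have k2 : kappa * a s <= kappa * `|A| by rewrite ler_pM2l// (le_trans a2).
  by rewrite /g /G ler_norml; apply/andP; split; lra.
have hc s : 0 <= s <= T -> `|h s| <= G * c s.
  move=> sT; have /andP[c1 c2] := c01 s; rewrite /h normrM (ger0_norm c1).
  have [Cs|Cs] := ltP 0 (C s); first by rewrite ler_wpM2r// gG.
  by rewrite /c min_l ?max_l ?mulr0// (le_trans Cs).
have hG s : 0 <= s <= T -> `|h s| <= G.
  move=> sT; rewrite (le_trans (hc s sT))// ler_piMr ?(ltW G0)//.
  by have /andP[] := c01 s.
have cC s : 0 < C s -> c s <= C s.
  by move=> Cs; rewrite /c ge_max (ltW Cs) ge_min lexx.
have ahi : lebesgue_measure.-integrable `[0, T] (fun s => (a s * h s)%:E).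
  apply: (@itvcc_bounded_integrable _ _ _ _ (A * G)); first exact: measurable_funM.
  move=> s sT; have /andP[a1 a2] := aA s sT.
  by rewrite normrM (ger0_norm a1) ler_pM// hG.
have hqi : lebesgue_measure.-integrable `[0, T] (fun s => (h s * q s)%:E).
  by apply: (@itvcc_integrableMl _ _ _ G).
have hhqi : lebesgue_measure.-integrable `[0, T] (fun s => (h s ^+ 2 * q s)%:E).
  apply: (@itvcc_integrableMl _ _ _ (G ^+ 2)) => //; first exact: measurable_funX.
  by move=> s sT; rewrite normrX lerXn2r ?nnegrE ?(ltW G0)// hG.
pose H := \int[lebesgue_measure]_(s in `[0, T]) (a s * h s).
pose P1 := \int[lebesgue_measure]_(s in `[0, T]) (h s * q s).
pose P2 := \int[lebesgue_measure]_(s in `[0, T]) (h s ^+ 2 * q s).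
have P20 : 0 <= P2.
  by apply: Rintegral_ge0 => s _; rewrite mulr_ge0 ?sqr_ge0.
have key e : 0 < e -> e * G < 1 -> beta * (e * G) <= 1 / 2 ->
    alpha * (e * `|H|) <= 1 / 2 ->
    P1 - kappa * H <= e * (2 * alpha * kappa * H ^+ 2 + 2 * beta * P2).
  move=> e0 eG bG aH.
  have mhe : measurable_fun `[0, T] (fun s => e * h s) by exact: measurable_funM.
  have he s : 0 <= s <= T -> `|e * h s| <= e * G.
    by move=> sT; rewrite normrM (gtr0_norm e0) ler_pM2l// hG.
  have hpos s : 0 <= s <= T -> 0 < C s -> 0 < C s + e * h s.
    move=> sT Cs.
    have h1 : `|e * h s| < C s.
      rewrite normrM (gtr0_norm e0).
      apply: (@le_lt_trans _ _ (e * (G * c s))); first by rewrite ler_pM2l// hc.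
      rewrite mulrA (@le_lt_trans _ _ (e * G * C s))//.
        by rewrite ler_wpM2l ?cC// mulr_ge0 ?ltW.
      by rewrite gtr_pMl.
    by move: h1; rewrite ltr_norml => /andP[h1 _]; lra.
  have := opt _ _ mhe he hpos.
  have -> : \int[lebesgue_measure]_(s in `[0, T]) (a s * (e * h s)) = e * H.
    by rewrite -RintegralZl//; apply: eq_Rintegral => s _; rewrite mulrCA.
  set V := \int[lebesgue_measure]_(s in `[0, T]) _.
  have V1 : V <= beta * (- e * P1 + 2 * beta * e ^+ 2 * P2).
    have -> : beta * (- e * P1 + 2 * beta * e ^+ 2 * P2)
      = \int[lebesgue_measure]_(s in `[0, T])
        (- (beta * e) * (h s * q s) + 2 * (beta * e) ^+ 2 * (h s ^+ 2 * q s)).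
      rewrite RintegralD//; last 2 first.
      - exact: EFin_integrableZl.
      - exact: EFin_integrableZl.
      by rewrite !RintegralZl// /P1 /P2; ring.
    apply: le_Rintegral => //.
    - apply: EFin_integrableB => //.
      apply: (@itvcc_integrableMr _ _ _ (expR (beta * (e * G)))) => //.
        apply: measurableT_comp => //; apply: measurableT_comp => //.
        exact: measurable_funM.
      move=> s sT; rewrite ger0_norm ?expR_ge0// ler_expR -mulrN ler_pM2l//.
      by have := he s sT; rewrite ler_norml => /andP[h1 _]; lra.
    - by apply: EFin_integrableD => //; exact: EFin_integrableZl.
    - move=> s; rewrite /= in_itv/= => sT.
      have b1 : - (beta * (e * h s)) <= 1 / 2.
        apply: le_trans bG; rewrite -mulrN ler_pM2l//.
        by have := he s sT; rewrite ler_norml => /andP[h1 _]; lra.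
      have := ler_wpM2l (q0 s) (expR_le_quadratic b1).
      lra.
  have a1 : alpha * (e * H) <= 1 / 2.
    apply: le_trans aH; rewrite !ler_pM2l//; exact: ler_norm.
  have U1 := expR_le_quadratic a1.
  have ak0 : 0 <= alpha^-1 * kappa by rewrite mulr_ge0 ?invr_ge0 ?ltW.
  have U2 := ler_wpM2l ak0 U1.
  have bi0 : 0 <= beta^-1 by rewrite invr_ge0 ltW.
  have V2 := ler_wpM2l bi0 V1.
  rewrite mulKf ?gt_eqF// in V2.
  have E : alpha^-1 * kappa * (1 + alpha * (e * H) + 2 * (alpha * (e * H)) ^+ 2)
     = alpha^-1 * kappa + kappa * e * H + 2 * alpha * kappa * e ^+ 2 * H ^+ 2.
    by field; rewrite gt_eqF.
  rewrite E in U2 => W.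
  rewrite -(ler_pM2l e0).
  have -> : e * (e * (2 * alpha * kappa * H ^+ 2 + 2 * beta * P2)) =
    2 * alpha * kappa * e ^+ 2 * H ^+ 2 + 2 * beta * e ^+ 2 * P2 by ring.
  lra.
have gh0 s : 0 <= g s * h s.
  rewrite /h mulrA -expr2 mulr_ge0 ?sqr_ge0//; by have /andP[] := c01 s.
have mgh : measurable_fun `[0, T] (fun s => (g s * h s)%:E).
  by apply/measurable_EFinP; exact: measurable_funM.
have ghE : \int[lebesgue_measure]_(s in `[0, T]) (g s * h s) = P1 - kappa * H.
  rewrite /P1 /H -RintegralZl// -RintegralB//; last exact: EFin_integrableZl.
  by apply: eq_Rintegral => s _; rewrite /g; ring.
have ghi : lebesgue_measure.-integrable `[0, T] (fun s => (g s * h s)%:E).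
  rewrite (_ : (fun s => _) = (fun s => (h s * q s - kappa * (a s * h s))%:E)).
    by apply: EFin_integrableB => //; exact: EFin_integrableZl.
  by apply/funext => s; congr EFin; rewrite /g; ring.
have S_le0 : P1 - kappa * H <= 0.
  rewrite leNgt; apply/negP => S0.
  pose M := 2 * alpha * kappa * H ^+ 2 + 2 * beta * P2.
  have al0' := ltW al0; have be0' := ltW be0; have ka0' := ltW ka0.
  have G0' := ltW G0; have S0' := ltW S0.
  have M0 : 0 <= M by rewrite /M addr_ge0 // mulr_ge0 // ?sqr_ge0 // mulr_ge0 // mulr_ge0.
  (* The step size is [N^-1]. The first three summands secure the smallness conditions of [key], the
     quotient makes [N * (P1 - kappa * H)] exceed [M], and [1] keeps [N] positive. *)
  pose N := 2 * alpha * `|H| + 2 * beta * G + 2 * G + 2 * M / (P1 - kappa * H) + 1.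
  have n1 : 0 <= 2 * alpha * `|H| by rewrite !mulr_ge0.
  have n2 : 0 <= 2 * beta * G by rewrite !mulr_ge0.
  have n3 : 0 <= 2 * M / (P1 - kappa * H) by rewrite divr_ge0// mulr_ge0.
  have N0 : 0 < N by rewrite /N; lra.
  have := key N^-1; rewrite invr_gt0 N0 => /(_ isT).
  have -> : N^-1 * G < 1 by rewrite mulrC ltr_pdivrMr// mul1r /N; lra.
  have -> : beta * (N^-1 * G) <= 1 / 2.
    rewrite mulrCA mulrC ler_pdivrMr// /N; lra.
  have -> : alpha * (N^-1 * `|H|) <= 1 / 2.
    rewrite mulrCA mulrC ler_pdivrMr// /N; lra.
  move=> /(_ isT isT isT); rewrite -/M ler_pdivlMl//; apply/negP; rewrite -ltNge.
  have -> : N * (P1 - kappa * H) = (P1 - kappa * H) *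
     (2 * alpha * `|H| + 2 * beta * G + 2 * G + 1) + (M + M).
    by rewrite /N; field; rewrite gt_eqF.
  rewrite ltr_pwDl ?lerDl// mulr_gt0// ltr_wpDl// !addr_ge0//.
  by rewrite mulr_ge0.
have ghz : (\int[lebesgue_measure]_(s in `[0%R, T]) `|(g s * h s)%:E| = 0)%E.
  under eq_integral do rewrite gee0_abs ?lee_fin//.
  have /fineK <- : (\int[lebesgue_measure]_(s in `[0%R, T]) (g s * h s)%:E)%E
    \is a fin_num by exact: integrable_fin_num.
  rewrite -[fine _]/(\int[lebesgue_measure]_(s in `[0, T]) (g s * h s)).
  congr EFin; apply/le_anti; rewrite ghE S_le0/= -ghE.
  by apply: Rintegral_ge0.
have ghae := (ae_eq_integral_abs lebesgue_measure (measurable_itv `[0, T]) mgh).1 ghz.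
have aeF : Filter (nbhs (almost_everywhere (@lebesgue_measure R))).
  exact: ae_filter_ringOfSetsType.
apply: filterS2 Cpos ghae => s Cs ghs0 sT.
have Cs0 := Cs sT.
have cs0 : 0 < c s by rewrite /c lt_max lt_min Cs0 ltr01 orbT.
have := ghs0 sT => -[] /eqP; rewrite /h/=.
rewrite mulf_eq0 mulf_eq0 (gt_eqF cs0) orbF orbb subr_eq0.
by move=> /eqP.
Qed.

Lemma quadratic_le0_linear_eq0 (R : realType) (p q : R) :
  (forall e, e * p - e ^+ 2 * q <= 0) -> p = 0.
Proof.
move=> H; apply/eqP/negPn/negP => p0.
have N0 : 0 < `|q| + 1 by rewrite ltr_wpDl.
(* A step along [p] short enough for the linear term to dominate the quadratic one. *)
have := H (p / (`|q| + 1)).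
have -> : p / (`|q| + 1) * p - (p / (`|q| + 1)) ^+ 2 * q =
  (p / (`|q| + 1)) ^+ 2 * (`|q| + 1 - q).
  by field; rewrite gt_eqF.
rewrite leNgt mulr_gt0// ?exprn_even_gt0//=.
  by rewrite mulf_neq0// invr_eq0 gt_eqF.
by have := ler_norm q; lra.
Qed.

(** [C] may be very negative on a null set, where the exponential is unbounded; clipping [C] at zero
    changes nothing almost everywhere and bounds it by 1. *)
Lemma utility_integrable (R : realType) (k T beta : R) (C : R -> R) :
  0 <= k -> 0 < beta -> measurable_fun `[0, T] C ->
  {ae lebesgue_measure, forall t, t \in `[0, T] -> 0 < C t} ->
  lebesgue_measure.-integrable `[0, T] (fun t => (expR (- (k * t) - beta * C t))%:E).
Proof.
move=> k0 b0 mC Cpos.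
have mu_ C' : measurable_fun `[0, T] C' ->
    measurable_fun `[0, T] (fun t => expR (- (k * t) - beta * C' t)).
  move=> mC'; apply: measurableT_comp => //; apply: measurable_funB.
    by apply: measurableT_comp => //; exact: measurable_funM.
  exact: measurable_funM.
pose C' t := Num.max (C t) 0.
have mC' : measurable_fun `[0, T] C' by exact: measurable_maxr.
have iC' : lebesgue_measure.-integrable `[0, T]
    (fun t => (expR (- (k * t) - beta * C' t))%:E).
  apply: (@itvcc_bounded_integrable _ _ _ _ 1); first exact: mu_.
  move=> t /andP[t0 _]; rewrite ger0_norm ?expR_ge0// -expR0 ler_expR.
  have : 0 <= k * t by rewrite mulr_ge0.
  have : 0 <= beta * C' t by rewrite mulr_ge0 ?(ltW b0)// /C' le_max lexx orbT.
  lra.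
apply/integrableP; split; first by apply/measurable_EFinP; exact: mu_.
have /integrableP[_] := iC'; apply: le_lt_trans.
rewrite le_eqVlt; apply/orP; left; apply/eqP; apply: ae_eq_integral => //.
- apply: measurableT_comp => //; apply/measurable_EFinP; exact: mu_.
- apply: measurableT_comp => //; apply/measurable_EFinP; exact: mu_.
- have aeF : Filter (nbhs (almost_everywhere (@lebesgue_measure R))).
    exact: ae_filter_ringOfSetsType.
  apply: filterS Cpos => t Ct tT; have Ct0 := Ct tT.
  by rewrite /C' max_l// ltW.
Qed.

(** * The deterministic objective and its optimality conditions *)

Section optimization.
Context {R : realType} {d : measure_display} {Omega : measurableType d}.
Variables (P : probability Omega R) (F : R -> set (set Omega)).
Variables (B : R -> Omega -> R).
Variables (r T sigma rho alpha1 alpha2 beta1 gamma1 theta v x1 : R).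
Hypothesis hF : filtration T F.
Hypothesis hB : brownian_motion P T F B.
Hypothesis r0 : 0 < r.
Hypothesis T0 : 0 < T.
Hypothesis s0 : 0 < sigma.
Hypothesis rho0 : 0 < rho.
Hypothesis al0 : 0 < alpha1.
Hypothesis be0 : 0 < beta1.
Hypothesis ga0 : 0 < gamma1.

Local Notation ce := (certainty_equivalent r T sigma v x1 alpha1).
Local Notation W t := (expR (r * (T - t))).

(** The slope [p] stays existential: optimality forces it to vanish, and only the quadratic
    coefficient survives in the final formula. *)
Lemma certainty_equivalent_line (I1 I2 C : R -> R) :
  measurable_fun `[0, T] I1 -> measurable_fun `[0, T] I2 ->
  lebesgue_measure.-integrable `[0, T] (fun t => (I1 t ^+ 2)%:E) ->
  lebesgue_measure.-integrable `[0, T] (fun t => (I2 t ^+ 2)%:E) ->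
  lebesgue_measure.-integrable `[0, T] (fun t => (C t)%:E) ->
  exists p, forall e, ce (fun t => (1 - e) * I1 t + e * I2 t) C =
    ce I1 C + e * p - e ^+ 2 * (alpha1 * sigma ^+ 2 / 2 *
      \int[lebesgue_measure]_(t in `[0, T]) ((W t * (I2 t - I1 t)) ^+ 2)).
Proof.
move=> m1 m2 i1 i2 Ci.
have l1 := sqr_integrable_itvcc m1 i1; have l2 := sqr_integrable_itvcc m2 i2.
have mW : measurable_fun `[0, T] (fun t : R => W t) by exact: measurable_expR_rev.
pose D t := I2 t - I1 t.
have mD : measurable_fun `[0, T] D by exact: measurable_funB.
have lD : lebesgue_measure.-integrable `[0, T] (fun t => (D t)%:E).
  exact: EFin_integrableB.
have D2 : lebesgue_measure.-integrable `[0, T] (fun t => (D t ^+ 2)%:E).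
  exact: sqr_integrableB.
have WW g : lebesgue_measure.-integrable `[0, T] (fun t => (g t)%:E) ->
    lebesgue_measure.-integrable `[0, T] (fun t => (W t * g t)%:E).
  by apply: expR_rev_integrableMl; exact: ltW.
have sqrW g : lebesgue_measure.-integrable `[0, T] (fun t => (g t ^+ 2)%:E) ->
    lebesgue_measure.-integrable `[0, T] (fun t => ((W t * g t) ^+ 2)%:E).
  move=> /WW/WW; congr (lebesgue_measure.-integrable _ _).
  by apply/funext => t; congr EFin; ring.
have WI := sqrW _ i1; have WD := sqrW _ D2.
have WID : lebesgue_measure.-integrable `[0, T]
    (fun t => ((W t * I1 t) * (W t * D t))%:E).
  apply: (@itvcc_le_integrable _ _ _ _
    (fun t => (W t * I1 t) ^+ 2 + (W t * D t) ^+ 2)).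
  - by apply: measurable_funM; exact: measurable_funM.
  - move=> t _; rewrite ler_norml.
    have h1 := sqr_ge0 (W t * I1 t + W t * D t).
    have h2 := sqr_ge0 (W t * I1 t - W t * D t).
    have h3 := sqr_ge0 (W t * I1 t); have h4 := sqr_ge0 (W t * D t).
    by apply/andP; split; lra.
  - exact: EFin_integrableD.
pose N1 := \int[lebesgue_measure]_(t in `[0, T]) ((W t * I1 t) ^+ 2).
pose N2 := \int[lebesgue_measure]_(t in `[0, T]) ((W t * I1 t) * (W t * D t)).
pose N3 := \int[lebesgue_measure]_(t in `[0, T]) ((W t * D t) ^+ 2).
pose L := \int[lebesgue_measure]_(t in `[0, T]) (W t * D t).
exists (v * L - alpha1 * sigma ^+ 2 * N2) => e.
rewrite /certainty_equivalent -/N1 -/N3.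
have -> : \int[lebesgue_measure]_(t in `[0, T])
     (W t * (v * ((1 - e) * I1 t + e * I2 t) - C t))
  = \int[lebesgue_measure]_(t in `[0, T]) (W t * (v * I1 t - C t)) + e * v * L.
  rewrite -RintegralZl//; last exact: WW.
  rewrite -RintegralD//.
  - by apply: eq_Rintegral => t _; rewrite /D; ring.
  - by apply: WW; apply: EFin_integrableB => //; exact: EFin_integrableZl.
  - by apply: EFin_integrableZl => //; exact: WW.
have -> : \int[lebesgue_measure]_(t in `[0, T])
     ((W t * ((1 - e) * I1 t + e * I2 t)) ^+ 2) = N1 + 2 * e * N2 + e ^+ 2 * N3.
  rewrite -RintegralZl// -RintegralZl// -RintegralD//; last exact: EFin_integrableZl.
  rewrite -RintegralD//; last 2 first.
  - by apply: EFin_integrableD => //; exact: EFin_integrableZl.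
  - exact: EFin_integrableZl.
  by apply: eq_Rintegral => t _; rewrite /D; ring.
by field.
Qed.

Lemma certainty_equivalent_consumption (I C C' : R -> R) :
  lebesgue_measure.-integrable `[0, T] (fun t => (I t)%:E) ->
  lebesgue_measure.-integrable `[0, T] (fun t => (C t)%:E) ->
  lebesgue_measure.-integrable `[0, T] (fun t => (C' t)%:E) ->
  ce I C' = ce I C -
    \int[lebesgue_measure]_(t in `[0, T]) (W t * (C' t - C t)).
Proof.
move=> Ii Ci Ci'; rewrite /certainty_equivalent.
have WW g : lebesgue_measure.-integrable `[0, T] (fun t => (g t)%:E) ->
    lebesgue_measure.-integrable `[0, T] (fun t => (W t * g t)%:E).
  by apply: expR_rev_integrableMl; exact: ltW.
have -> : \int[lebesgue_measure]_(t in `[0, T]) (W t * (v * I t - C' t)) =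
  \int[lebesgue_measure]_(t in `[0, T]) (W t * (v * I t - C t)) -
  \int[lebesgue_measure]_(t in `[0, T]) (W t * (C' t - C t)).
  rewrite -RintegralB//.
  - by apply: eq_Rintegral => t _; ring.
  - by apply: WW; apply: EFin_integrableB => //; exact: EFin_integrableZl.
  - by apply: WW; exact: EFin_integrableB.
ring.
Qed.

Definition consumption_utility (C : R -> R) : R :=
  \int[lebesgue_measure]_(t in `[0, T]) expR (- (rho * r * t) - beta1 * C t).

Definition herding_cost (I : R -> R) : R :=
  \int[lebesgue_measure]_(t in `[0, T]) (expR (rho * r * (T - t))
    * (I t - leader_investment r T sigma alpha2 v t) ^+ 2).

Definition objective (I C : R -> R) : R :=
  - (alpha1^-1 * expR (- (alpha1 * ce I C)))
  - gamma1 * (beta1^-1 * consumption_utility C) - theta / 2 * herding_cost I.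

Lemma herding_integrable (I : R -> R) :
  measurable_fun `[0, T] I ->
  lebesgue_measure.-integrable `[0, T] (fun t => (I t ^+ 2)%:E) ->
  lebesgue_measure.-integrable `[0, T] (fun t => (expR (rho * r * (T - t))
    * (I t - leader_investment r T sigma alpha2 v t) ^+ 2)%:E).
Proof.
move=> mI I2; apply: expR_rev_integrableMl; first by rewrite mulr_ge0// ltW.
have mL : measurable_fun `[0, T] (leader_investment r T sigma alpha2 v).
  apply: measurable_funM => //; apply: measurableT_comp => //.
  by apply: measurable_funM => //; exact: measurable_funB.
apply: sqr_integrableB => //.
apply: (@itvcc_bounded_integrable _ _ _ _ ((v / (alpha2 * sigma ^+ 2)) ^+ 2)).
  exact: measurable_funX.
move=> t /andP[_ tT]; rewrite ger0_norm ?sqr_ge0// /leader_investment exprMn.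
rewrite ler_piMr ?sqr_ge0// expr_le1// ?expR_ge0// -expR0 ler_expR.
by rewrite mulr_ge0_le0 ?subr_le0// ltW.
Qed.

(** Removes the process: the value depends on the pair alone and is finite, so the extended supremum
    in [optimal] becomes a family of real inequalities. *)
Lemma objectiveE (I C : R -> R) (X : R -> Omega -> R) :
  admissible T I C -> fund_process P F B r T sigma v x1 I C X ->
  J P r T sigma rho alpha1 alpha2 beta1 gamma1 theta v I C X = (objective I C)%:E.
Proof.
move=> adm fp; have mgf := fund_terminal_mgf hF hB r0 T0 alpha1 s0 adm fp.
have [aX _] := fp; have [mI [I2 [Ci Cpos]]] := adm.
have mX : measurable_fun setT (X T).
  by apply: (adapted_measurable hF aX); rewrite lexx (ltW T0).
have mC : measurable_fun `[0, T] C by apply/measurable_EFinP; exact: measurable_int Ci.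
have iX : P.-integrable setT (fun w => (expR (- (alpha1 * X T w)))%:E).
  apply/integrableP; split.
    apply/measurable_EFinP; apply: measurableT_comp => //.
    by apply: measurableT_comp => //; exact: measurable_funM.
  under eq_integral do rewrite gee0_abs ?lee_fin ?expR_ge0//.
  by rewrite mgf ltry.
have ui : lebesgue_measure.-integrable `[0, T]
    (fun t => (expR (- (rho * r * t) - beta1 * C t))%:E).
  by apply: utility_integrable => //; rewrite mulr_ge0// ltW.
have hi := herding_integrable mI I2.
rewrite /J unlock /objective.
under eq_integral do rewrite -mulNr EFinM.
rewrite integralZl// mgf.
under [X in (_ + _ * X)%E]eq_integral do rewrite -mulNr EFinM.
rewrite integralZl//.
have -> : (\int[lebesgue_measure]_(t in `[0%R, T])
    (expR (- (rho * r * t) - beta1 * C t))%:E)%E = (consumption_utility C)%:E.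
  by rewrite /consumption_utility fineK//; exact: integrable_fin_num.
have -> : (\int[lebesgue_measure]_(t in `[0%R, T]) (expR (rho * r * (T - t))
    * (I t - leader_investment r T sigma alpha2 v t) ^+ 2)%:E)%E
    = (herding_cost I)%:E.
  by rewrite /herding_cost fineK//; exact: integrable_fin_num.
by rewrite -!EFinM -EFinN -!EFinD; congr EFin; ring.
Qed.

Lemma optimal_objective (I C I' C' : R -> R) (X' : R -> Omega -> R) :
  optimal P F B r T sigma rho alpha1 alpha2 beta1 gamma1 theta v x1 I C ->
  admissible T I' C' -> fund_process P F B r T sigma v x1 I' C' X' ->
  objective I' C' <= objective I C.
Proof.
move=> [adm [X [fp JE]]] adm' fp'.
rewrite -lee_fin -(objectiveE adm fp) -(objectiveE adm' fp') JE.
by apply: ereal_sup_ubound; exists I', C', X'.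
Qed.

(** A change of consumption leaves the herding cost untouched, so that term cancels and the same
    condition holds for every [theta]. The left side is marginal utility of consumption, the right
    side that of terminal wealth, compounded from [t] to [T]. *)
Lemma optimal_consumption (I C : R -> R) :
  optimal P F B r T sigma rho alpha1 alpha2 beta1 gamma1 theta v x1 I C ->
  {ae lebesgue_measure, forall t, t \in `[0, T] ->
    gamma1 * expR (- (rho * r * t) - beta1 * C t) =
    expR (- (alpha1 * ce I C)) * W t}.
Proof.
move=> opt; have [adm [X [fp _]]] := opt.
have [mI [I2 [Ci Cpos]]] := adm.
have mC : measurable_fun `[0, T] C by apply/measurable_EFinP; exact: measurable_int Ci.
have rr0 : 0 <= rho * r by rewrite mulr_ge0// ltW.
have ui := utility_integrable rr0 be0 mC Cpos.
pose q t := gamma1 * expR (- (rho * r * t) - beta1 * C t).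
apply: (@consumption_first_order _ T alpha1 beta1 _ (expR (r * T)) gamma1
  (fun t => W t) q C) => //.
- exact: expR_gt0.
- exact: measurable_expR_rev.
- move=> t /andP[t0 _]; rewrite expR_ge0/=.
  by rewrite (le_trans (ler_norm _))// expR_rev_le// ltW.
- exact: EFin_integrableZl.
- by move=> t; rewrite mulr_ge0 ?expR_ge0// ltW.
- move=> t /andP[t0 _] Ct; rewrite /q ler_piMr ?(ltW ga0)// -expR0 ler_expR.
  have : 0 <= rho * r * t by rewrite mulr_ge0.
  have : 0 <= beta1 * C t by rewrite mulr_ge0 ?(ltW be0)// ltW.
  lra.
move=> h G mh hG hpos.
have hi : lebesgue_measure.-integrable `[0, T] (fun t => (h t)%:E).
  exact: itvcc_bounded_integrable hG.
pose C' t := C t + h t.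
have Ci' : lebesgue_measure.-integrable `[0, T] (fun t => (C' t)%:E).
  exact: EFin_integrableD.
have aeF : Filter (nbhs (almost_everywhere (@lebesgue_measure R))).
  exact: ae_filter_ringOfSetsType.
have Cpos' : {ae lebesgue_measure, forall t, t \in `[0, T] -> 0 < C' t}.
  apply: filterS Cpos => t Ct /[dup] tT; rewrite in_itv/= => tT'.
  by apply: hpos => //; exact: Ct.
have adm' : admissible T I C' by [].
(* Combining the pair with itself at [e = 0] keeps the investment and replaces only the
   consumption. *)
have [X' fp'] := fund_process_comb hF hB T0 0 adm adm Ci' fp fp.
have IE : (fun t => (1 - 0) * I t + 0 * I t) = I.
  by apply/funext => t; rewrite subr0 mul1r mul0r addr0.
rewrite IE in fp'; have := optimal_objective opt adm' fp'.
have mC' : measurable_fun `[0, T] C' by exact: measurable_funD.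
have ui' := utility_integrable rr0 be0 mC' Cpos'.
have Ii := sqr_integrable_itvcc mI I2.
rewrite /objective (certainty_equivalent_consumption Ii Ci Ci').
have -> : \int[lebesgue_measure]_(t in `[0, T]) (W t * (C' t - C t)) =
    \int[lebesgue_measure]_(t in `[0, T]) (W t * h t).
  by apply: eq_Rintegral => t _; rewrite /C' addrAC subrr add0r.
have -> : \int[lebesgue_measure]_(t in `[0, T])
    (q t * expR (- (beta1 * h t)) - q t)
  = gamma1 * consumption_utility C' - gamma1 * consumption_utility C.
  transitivity (\int[lebesgue_measure]_(t in `[0, T])
      (gamma1 * expR (- (rho * r * t) - beta1 * C' t) - q t)).
    apply: eq_Rintegral => t _; rewrite /q -mulrA -expRD.
    by congr (_ * expR _ - _); rewrite /C'; ring.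
  rewrite RintegralB//; last 2 first.
  - exact: EFin_integrableZl.
  - exact: EFin_integrableZl.
  rewrite (RintegralZl gamma1 _ ui')//.
  by rewrite (RintegralZl gamma1 _ ui)//.
set H := \int[lebesgue_measure]_(t in `[0, T]) (W t * h t).
have -> : - (alpha1 * (ce I C - H)) = - (alpha1 * ce I C) + alpha1 * H by ring.
rewrite expRD.
set k := expR (- _); set U := consumption_utility C; set U' := consumption_utility C'.
set E := expR _; move: (theta / 2 * _) => V.
have -> : alpha1^-1 * k * (E - 1) + beta1^-1 * (gamma1 * U' - gamma1 * U) =
  (- (alpha1^-1 * k) - gamma1 * (beta1^-1 * U) - V)
  - (- (alpha1^-1 * (k * E)) - gamma1 * (beta1^-1 * U') - V) by ring.
by rewrite subr_ge0.
Qed.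

End optimization.

(** * The crowding-out formula *)

Lemma admissible_line (R : realType) (T e : R) (I1 I2 C1 C2 : R -> R) :
  admissible T I1 C1 -> admissible T I2 C2 ->
  admissible T (fun t => (1 - e) * I1 t + e * I2 t) C1.
Proof.
move=> [m1 [i1 [Ci Cpos]]] [m2 [i2 _]].
have m : measurable_fun `[0, T] (fun t => (1 - e) * I1 t + e * I2 t).
  by apply: measurable_funD; exact: measurable_funM.
split => //; split => //.
apply: (@itvcc_le_integrable _ _ _ _
  (fun t => 2 * (1 - e) ^+ 2 * I1 t ^+ 2 + 2 * e ^+ 2 * I2 t ^+ 2)).
- exact: measurable_funX.
- move=> t _; rewrite ger0_norm ?sqr_ge0//.
  by rewrite (le_trans (sqr_addr_le _ _))// !exprMn !mulrA.
- by apply: EFin_integrableD => //; exact: EFin_integrableZl.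
Qed.

Theorem theorem3 (R : realType) (d : measure_display)
    (Omega : measurableType d) (P : probability Omega R)
    (F : R -> set (set Omega)) (B : R -> Omega -> R)
    (r T sigma rho alpha1 alpha2 beta1 gamma1 theta v x1 : R)
    (hF : complete_filtered_space P T F)
    (hB : brownian_motion P T F B)
    (hr : 0 < r) (hT : 0 < T) (hsigma : 0 < sigma) (hrho : 0 < rho)
    (halpha1 : 0 < alpha1) (halpha2 : 0 < alpha2) (hbeta1 : 0 < beta1)
    (hgamma1 : 0 < gamma1) (htheta : 0 <= theta)
    (Ibar Cbar Istar Cstar : R -> R)
    (hbar : optimal P F B r T sigma rho alpha1 alpha2 beta1 gamma1 0 v x1
              Ibar Cbar)
    (hstar : optimal P F B r T sigma rho alpha1 alpha2 beta1 gamma1 theta v x1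
              Istar Cstar) :
  let crowding_out : R :=
    alpha1 * sigma ^+ 2 / 2
    * (beta1 / alpha1 + (expR (r * T) - 1) / r)^-1
    * \int[lebesgue_measure]_(t in `[0, T])
        (expR (2 * r * (T - t)) * (Istar t - Ibar t) ^+ 2) in
  {ae lebesgue_measure, forall t, t \in `[0, T] ->
     Cbar t - Cstar t = crowding_out}
  /\ 0 <= crowding_out.
Proof.
move=> crowding_out; have [_ [hF' _]] := hF.
have [admb [Xb [fpb _]]] := hbar; have [adms [Xs [fps _]]] := hstar.
have [mIb [Ib2 [Cbi Cbpos]]] := admb; have [mIs [Is2 [Csi Cspos]]] := adms.
have focb := optimal_consumption hF' hB hr hT hsigma hrho halpha1 hbeta1 hgamma1 hbar.
have focs := optimal_consumption hF' hB hr hT hsigma hrho halpha1 hbeta1 hgamma1 hstar.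
pose ce := certainty_equivalent r T sigma v x1 alpha1.
rewrite -/ce in focb focs.
have [p] := certainty_equivalent_line sigma alpha1 v x1 hr mIb mIs Ib2 Is2 Cbi.
rewrite -/ce; set N3 := (X in _ * X) => line.
(* At [theta = 0] and with the consumption kept at [Cbar], the two objectives differ only in the
   utility of terminal wealth, so optimality compares certainty equivalents. *)
have ce_line e : ce (fun t => (1 - e) * Ibar t + e * Istar t) Cbar <= ce Ibar Cbar.
  have [X' fp'] := fund_process_comb hF' hB hT e admb adms Cbi fpb fps.
  have adm' := admissible_line e admb adms.
  have := optimal_objective hF' hB hr hT hsigma hrho hbeta1 hbar adm' fp'.
  rewrite /objective -/ce !mul0r !subr0 lerD2r lerN2 ler_pM2l ?invr_gt0//.
  by rewrite ler_expR lerN2 ler_pM2l.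
have p0 : p = 0.
  apply: (@quadratic_le0_linear_eq0 _ _ (alpha1 * sigma ^+ 2 / 2 * N3)) => e.
  by have := ce_line e; rewrite line; lra.
have ce_star : ce Istar Cbar = ce Ibar Cbar - alpha1 * sigma ^+ 2 / 2 * N3.
  have IE : (fun t => (1 - 1) * Ibar t + 1 * Istar t) = Istar.
    by apply/funext => t; rewrite subrr mul0r mul1r add0r.
  by have := line 1; rewrite IE p0 mulr0 addr0 expr1n mul1r.
have Isi := sqr_integrable_itvcc mIs Is2.
have := certainty_equivalent_consumption sigma alpha1 v x1 hr Isi Csi Cbi.
rewrite -/ce ce_star => ceE.
pose c := alpha1 / beta1 * (ce Ibar Cbar - ce Istar Cstar).
have aeF : Filter (nbhs (almost_everywhere (@lebesgue_measure R))).
  exact: ae_filter_ringOfSetsType.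
have Cc : {ae lebesgue_measure, forall t, t \in `[0, T] -> Cbar t - Cstar t = c}.
  apply: filterS2 focb focs => t Eb Es tT.
  have := Eb tT; have := Es tT.
  set kb := ce Ibar Cbar; set ks := ce Istar Cstar.
  set W := expR (r * _) => es eb.
  (* Cross-multiplying the two conditions: both sides equal [W * expR (- (alpha1 * (kb + ks)))], and
     each is a single exponential, so that [expR_inj] applies without logarithms. *)
  have : gamma1 * expR (- (rho * r * t) - beta1 * Cbar t - alpha1 * ks)
    = gamma1 * expR (- (rho * r * t) - beta1 * Cstar t - alpha1 * kb).
    rewrite (expRD (- (rho * r * t) - beta1 * Cbar t)).
    by rewrite (expRD (- (rho * r * t) - beta1 * Cstar t)) !mulrA eb es; ring.
  move=> /mulfI; rewrite gt_eqF// => /(_ isT) /expR_inj E.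
  rewrite /c -/kb -/ks; apply: (mulfI (lt0r_neq0 hbeta1)).
  have -> : beta1 * (alpha1 / beta1 * (kb - ks)) = alpha1 * (kb - ks).
    by field; rewrite gt_eqF.
  by lra.
have Wc : \int[lebesgue_measure]_(t in `[0, T])
    (expR (r * (T - t)) * (Cbar t - Cstar t)) = c * ((expR (r * T) - 1) / r).
  transitivity (\int[lebesgue_measure]_(t in `[0, T]) (c * expR (r * (T - t)))).
    congr fine; apply: ae_eq_integral => //.
    - apply: measurable_int; apply: expR_rev_integrableMl (ltW hr) _.
      exact: EFin_integrableB.
    - apply: measurable_int; apply: EFin_integrableZl => //.
      exact: expR_rev_integrable.
    - apply: filterS Cc => t Ct tT; congr EFin; rewrite mulrC; congr (_ * _).
      exact: Ct.
  rewrite RintegralZl//; last exact: expR_rev_integrable.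
  congr (_ * _); have := @Rintegral_expR_rev _ r T 0 T (ltW hT).
  rewrite subrr subr0 mulr0 expR0 RintegralZl//; last exact: expR_rev_integrable.
  by move=> <-; rewrite mulrC mulKf// gt_eqF.
have eT : 0 < expR (r * T) - 1 by rewrite subr_gt0 expR_gt1 mulr_gt0.
have den0 : 0 < beta1 / alpha1 + (expR (r * T) - 1) / r.
  by rewrite addr_gt0 ?divr_gt0.
have crowdE : crowding_out = alpha1 * sigma ^+ 2 / 2
    * (beta1 / alpha1 + (expR (r * T) - 1) / r)^-1 * N3.
  congr (_ * _); apply: eq_Rintegral => t _.
  rewrite exprMn -expRM_natl; congr (expR _ * _); ring.
have N30 : 0 <= N3 by apply: Rintegral_ge0 => t _; exact: sqr_ge0.
split; last first.
  rewrite crowdE mulr_ge0// mulr_ge0// ?invr_ge0 ?(ltW den0)//.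
  by rewrite divr_ge0// mulr_ge0 ?sqr_ge0// ltW.
apply: filterS Cc => t Ct tT; rewrite (Ct tT) crowdE.
(* [c] enters twice: [beta1 / alpha1 * c] is the difference of the certainty equivalents, and that
   difference contains in turn the compounded cost of the extra consumption [c]. Collecting both
   contributions produces the inverted bracket. *)
rewrite -mulrA mulrCA; apply: (mulfI (lt0r_neq0 den0)).
rewrite mulVKf ?gt_eqF//.
move: ceE; rewrite Wc => ceE.
have cK : beta1 / alpha1 * c = ce Ibar Cbar - ce Istar Cstar.
  by rewrite /c; field; rewrite !gt_eqF.
by rewrite mulrDl cK; lra.
Qed.
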